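(* Let $X$ be a positive, not almost surely constant random variable with $\mathbb E X=1$ and $\mathbb E X^{-1}<\infty$, and, if the moment estimators are used, also $\mathbb E X^2<\infty$. Let $X_1,X_2,\dots$ be i.i.d. copies of $X$, let $(\widehat\mu_n,\widehat\lambda_n)$ be either the maximum likelihood estimators (ML) or the moment estimators (MO) computed from $X_1,\dots,X_n$, let $w$ be an admissible weight function, and let $T_n=T_n(X_1,\dots,X_n)$ be the test statistic. Let $\varphi>0$ be the almost sure limit of $\widehat\varphi_n=\widehat\lambda_n/\widehat\mu_n$, i.e. $\varphi=(\mathbb E X^{-1}-1)^{-1}$ for ML and $\varphi=(\mathbb E X^2-1)^{-1}$ for MO. Then, as $n\to\infty$, $$\frac{T_n}{n}\longrightarrow\Delta_\varphi=\int_0^\infty\left|\mathbb E\left[\frac12\left(\varphi+\frac3X-\frac{\varphi}{X^2}\right)\min\{X,t\}\right]-\mathbb P(X\le t)\right|^2w(t)\,dt\quad\text{in probability.}$$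
   Context: Estimators, for a sample $x_1,\dots,x_n>0$ with mean $\overline x_n=\frac1n\sum_j x_j$: (ML) $\widehat\mu_n=\overline x_n$, $\widehat\lambda_n=\Big(\frac1n\sum_{j=1}^n\big(x_j^{-1}-\overline x_n^{-1}\big)\Big)^{-1}$. (MO) $\widehat\mu_n=\overline x_n$, $\widehat\lambda_n=\widehat\mu_n^3\big/\big(\frac1n\sum_{j=1}^n x_j^2-\widehat\mu_n^2\big)$. Test statistic: with $\widehat\varphi_n=\widehat\lambda_n/\widehat\mu_n$ and $Y_{n,j}=x_j/\widehat\mu_n$, $$T_n(x_1,\dots,x_n)=n\int_0^\infty\left|\frac1{2n}\sum_{j=1}^n\Big(\widehat\varphi_n+\frac3{Y_{n,j}}-\frac{\widehat\varphi_n}{Y_{n,j}^2}\Big)\min\{Y_{n,j},t\}-\frac1n\sum_{j=1}^n\mathbf 1\{Y_{n,j}\le t\}\right|^2w(t)\,dt .$$ It is invariant under scaling of the data, which is why the paper normalizes $\mathbb E X=1$ in this setting. (The estimators are finite for all sufficiently large $n$, almost surely.) Admissible weight: $w:(0,\infty)\to(0,\infty)$ is continuous, $\int_0^\infty(t^2+1)w(t)\,dt<\infty$, and $n\int_0^\infty|w(\widehat\mu_n^{-1}s)-w(s)|^3\,w(s)^{-2}\,ds\to0$ in probability as $n\to\infty$, where $\widehat\mu_n$ is computed from the sample $X_1,\dots,X_n$ under consideration. *)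

(* Defs.v *)
From HB Require Import structures.
From mathcomp Require Import all_boot all_order all_algebra.
From mathcomp Require Import all_classical all_reals all_analysis.
From mathcomp Require Import finmap.

Set Implicit Arguments.
Unset Strict Implicit.
Unset Printing Implicit Defensive.

Import Order.TTheory GRing.Theory Num.Theory.
Import numFieldNormedType.Exports.

Local Open Scope classical_set_scope.
Local Open Scope ring_scope.

Section Probability.
Context {d : measure_display} {Omega : measurableType d} {R : realType}.
Variable P : probability Omega R.

(* The limit is finite whenever this holds: for l = +oo or l = -oo, the quantity
   `|Z n om - l| is always +oo. *)
Definition cvg_in_probability (Z : nat -> Omega -> \bar R) (l : \bar R) : Prop :=
  forall eps : R, 0 < eps ->
    P [set om | (eps%:E < `|Z n om - l|)%E] @[n --> \oo] --> 0%E.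

Definition mutually_independent (X : nat -> {RV P >-> R}) : Prop :=
  forall (J : {fset nat}) (A : nat -> set R),
    (forall j, measurable (A j)) ->
    P (\bigcap_(j in [set` J]) (X j @^-1` A j)) =
      (\prod_(j <- J) P (X j @^-1` A j))%E.

Definition same_distribution (X Y : {RV P >-> R}) : Prop :=
  forall A : set R, measurable A -> distribution P X A = distribution P Y A.

Definition iid_copies (X : {RV P >-> R}) (Xs : nat -> {RV P >-> R}) : Prop :=
  mutually_independent Xs /\ forall j, same_distribution (Xs j) X.

End Probability.

Inductive estimation_method := ML | MO.

Section Statistic.
Context {R : realType}.

(* Division by zero follows the convention 0^-1 = 0, so lambda_hat is 0 where
   the estimator is infinite (all observations equal). *)
Definition mu_hat n (x : 'I_n -> R) : R := n%:R^-1 * \sum_(j < n) x j.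

Definition lambda_hat (m : estimation_method) n (x : 'I_n -> R) : R :=
  match m with
  | ML => (n%:R^-1 * \sum_(j < n) ((x j)^-1 - (mu_hat x)^-1))^-1
  | MO => mu_hat x ^+ 3 / (n%:R^-1 * \sum_(j < n) x j ^+ 2 - mu_hat x ^+ 2)
  end.

Definition phi_hat (m : estimation_method) n (x : 'I_n -> R) : R :=
  lambda_hat m x / mu_hat x.

Definition T_stat (w : R -> R) (m : estimation_method) n (x : 'I_n -> R) :
    \bar R :=
  let Y := fun j : 'I_n => x j / mu_hat x in
  let ph := phi_hat m x in
  (n%:R%:E * \int[lebesgue_measure]_(t in `]0%R, +oo[)
    (`| (2 * n%:R)^-1 *
          \sum_(j < n) ((ph + 3 / Y j - ph / Y j ^+ 2) * Num.min (Y j) t)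
        - n%:R^-1 * \sum_(j < n) (Y j <= t)%R%:R | ^+ 2 * w t)%:E)%E.

End Statistic.

Section Limit.
Context {d : measure_display} {Omega : measurableType d} {R : realType}.
Variable P : probability Omega R.

Definition sample (Xs : nat -> {RV P >-> R}) n (om : Omega) : 'I_n -> R :=
  fun j => Xs j om.

(* The weight lives on ]0, +oo[; its values elsewhere are irrelevant. *)
Definition admissible_weight (Xs : nat -> {RV P >-> R}) (w : R -> R) : Prop :=
  [/\ forall t, 0 < t -> 0 < w t,
      {within `]0, +oo[, continuous w},
      (\int[lebesgue_measure]_(t in `]0%R, +oo[) ((t ^+ 2 + 1) * w t)%:E
         < +oo)%E &
      cvg_in_probability P
        (fun n om =>
           n%:R%:E * \int[lebesgue_measure]_(s in `]0%R, +oo[)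
             (`|w ((mu_hat (sample Xs (n := n) om))^-1 * s) - w s| ^+ 3
                / w s ^+ 2)%:E)%E
        0%E].

Definition phi_lim (m : estimation_method) (X : {RV P >-> R}) : R :=
  match m with
  | ML => (fine 'E_P[fun om => (X om)^-1] - 1)^-1
  | MO => (fine 'E_P[fun om => X om ^+ 2] - 1)^-1
  end.

Definition Delta (w : R -> R) (X : {RV P >-> R}) (ph : R) : \bar R :=
  (\int[lebesgue_measure]_(t in `]0%R, +oo[)
    (`| 'E_P[fun om => (2^-1 * (ph + 3 / X om - ph / X om ^+ 2)
                          * Num.min (X om) t)%R]
        - P [set om | (X om <= t)%R] | ^+ 2 * (w t)%:E))%E.

End Limit.

(* Main.v *)
(* For fixed t > 0 the inner expression of T_n is bounded by a quantity converging
   in probability and, unless t is an atom of X, converges in probability to its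
   limit: replacing Y_j = X_j / mean by X_j costs at most a multiple of
   |mean - 1| times averages of X_j^(1-k), k <= 2, and the weak law of large
   numbers (truncation and Chebyshev) does the rest. Atoms being countable, Tonelli,
   dominated convergence in t against the finite measure w(t) dt, and Markov's
   inequality transfer this to the integral. *)

Require Import Defs.
From HB Require Import structures.
From mathcomp Require Import finmap.
From mathcomp Require Import all_boot all_order all_algebra.
From mathcomp Require Import all_classical all_reals all_analysis.
From mathcomp Require Import ring lra measurable_realfun.

Set Implicit Arguments.
Unset Strict Implicit.
Unset Printing Implicit Defensive.

Import Order.TTheory GRing.Theory Num.Theory.
Import numFieldNormedType.Exports.

Local Open Scope classical_set_scope.
Local Open Scope ring_scope.

(** The random mean and [phi_hat] enter every summand, so each limit is one of sums, products and
    quotients of random quantities. Convergence in probability is therefore expressed as convergence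
    along a filter on pairs (n, omega), and the usual calculus of limits and squeezing carries over.
    Negative moments are scarce: only E X^-1 is known to be finite. The factor 1/X^2 is thus never
    separated from min{X,t} <= X, and every error estimate has to be a multiple of X^(1-k) rather
    than of t/X^k. The bound on the inner expression holds only with probability tending to 1, so
    the expression is truncated at that bound before any expectation is taken. Positivity is given
    almost surely, while the pointwise estimates divide by observations. They are carried out for
    modified observations that are positive everywhere, and the result is transferred back. Finally,
    the limit of [phi_hat] exists as a quotient because its denominator is nonzero; this is where X
    not being constant enters. *)

(** * Measurability of inversion and of indicators *)

Lemma measurable_invr {R : realType} : measurable_fun setT (@GRing.inv R).
Proof.
(* Inversion is continuous only away from 0, so the point 0 is split off. *)
have -> : setT = [set 0 : R] `|` [set~ 0] by rewrite setUv.
apply/measurable_funU => //; first exact: measurableC.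
split; first exact: measurable_fun_set1.
apply: open_continuous_measurable_fun.
  apply: closed_openC; apply: accessible_closed_set1.
  exact: hausdorff_accessible.
by move=> x /set_mem /= /eqP x0; exact: inv_continuous.
Qed.

Lemma measurable_fun_natr_bool {d} {T : measurableType d} {R : realType}
  (b : T -> bool) : measurable_fun setT b ->
  measurable_fun setT (fun x => (b x)%:R : R).
Proof.
move=> mb; rewrite (_ : (fun _ => _) = fun x => if b x then 1 else 0).
  exact: measurable_fun_ifT.
by apply/funext => x; case: (b x).
Qed.

(** * Convergence in probability as convergence along a filter *)

Section whp.
Context {d : measure_display} {Omega : measurableType d} {R : realType}.
Variable P : probability Omega R.

(* Convergence in probability of [Z : nat * Omega -> R] is convergence along
   this filter, so that the limit calculus of the library applies to it. The
   exceptional sets are covered by measurable ones because the value of [P] on a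
   nonmeasurable set is meaningless. *)
Definition whp : set_system (nat * Omega) :=
  [set A | exists B : nat -> set Omega,
    [/\ forall n, measurable (B n), P (B n) @[n --> \oo] --> 0%E &
        forall n om, ~ B n om -> A (n, om)]].

Global Instance whp_filter : Filter whp.
Proof.
constructor.
- exists (fun=> set0); split => //; apply: cvg_near_cst.
  by apply: nearW => n; rewrite measure0.
- move=> A A' [B [mB B0 BA]] [B' [mB' B'0 BA']].
  exists (fun n => B n `|` B' n); split.
  + by move=> n; exact: measurableU.
  + apply: (@squeeze_cvge _ _ _ _ (cst 0%E) _ (fun n => P (B n) + P (B' n))%E).
    * near=> n; rewrite measure_ge0/=; exact: measureU2.
    * exact: cvg_cst.
    * by rewrite -(add0e 0%E); exact: cvgeD.
  + by move=> n om /not_orP[nB nB']; split; [exact: BA|exact: BA'].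
- move=> A A' AA' [B [mB B0 BA]]; exists B; split => // n om nB.
  exact/AA'/BA.
Unshelve. all: by end_near. Qed.

Lemma whpI (A : set (nat * Omega)) (B : nat -> set Omega) :
  (forall n, measurable (B n)) -> P (B n) @[n --> \oo] --> 0%E ->
  (forall n om, ~ B n om -> A (n, om)) -> whp A.
Proof. by move=> mB B0 BA; exists B. Qed.

Lemma near_whp (Q : nat -> Prop) :
  (\forall n \near \oo, Q n) -> \forall u \near whp, Q u.1.
Proof.
move=> [N _ NQ]; exists (fun n => if (N <= n)%N then set0 else setT); split.
- by move=> n; case: ifP.
- apply: cvg_near_cst.
  by near=> n; rewrite ifT ?measure0//; near: n; exact: nbhs_infty_ge.
- by move=> n om; case: ifPn => [Nn _|_ /(_ I)//]; exact: NQ.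
Unshelve. all: by end_near. Qed.

(** The filter only supplies a measurable cover of the deviation event; monotonicity of [P]
    transfers the limit to the event itself, which is why its measurability is assumed. *)
Lemma whp_cvg_in_probability (Z : nat -> Omega -> \bar R) (l : \bar R) :
  (forall n eps, measurable [set om | (eps%:E < `|Z n om - l|)%E]) ->
  (forall eps : R, 0 < eps ->
    \forall u \near whp, (`|Z u.1 u.2 - l| <= eps%:E)%E) ->
  cvg_in_probability P Z l.
Proof.
move=> mZ Zl eps eps0; have [B [mB B0 BZ]] := Zl _ eps0.
apply: (@squeeze_cvge _ _ _ _ (cst 0%E) _ (fun n => P (B n))%E) => //.
- near=> n; rewrite measure_ge0/=; apply: le_measure; rewrite ?inE//.
  move=> om /=; apply: contraPP => /BZ/=; rewrite leNgt => /negP.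
  exact.
- exact: cvg_cst.
Unshelve. all: by end_near. Qed.

Lemma markov_ge0 (f : Omega -> \bar R) (eps : R) : measurable_fun setT f ->
  (forall om, 0 <= f om)%E -> 0 < eps ->
  (eps%:E * P [set om | (eps%:E <= f om)%E] <= \int[P]_om f om)%E.
Proof.
move=> mf f0 eps0.
have /= := @le_integral_comp_abse _ _ _ P _ measurableT f eps idfun
  (@measurable_id _ _ _) (fun r r0 => r0) (fun x y _ _ xy => xy) mf eps0.
rewrite setTI; under eq_set do rewrite gee0_abs//.
by under eq_integral do rewrite gee0_abs//.
Qed.

(** Convergence in mean implies convergence in probability, by Markov's inequality; the exceptional
    sets are the level sets of [f n]. *)
Lemma whp_lt_of_cvg_integral (f : nat -> Omega -> \bar R) (eps : R) :
  (forall n, measurable_fun setT (f n)) -> (forall n om, 0 <= f n om)%E ->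
  (\int[P]_om f n om @[n --> \oo] --> 0)%E -> 0 < eps ->
  \forall u \near whp, (f u.1 u.2 < eps%:E)%E.
Proof.
move=> mf f0 intf eps0.
apply: (@whpI _ (fun n => [set om | (eps%:E <= f n om)%E])).
- by move=> n; rewrite -[X in measurable X]setTI; exact: emeasurable_fun_c_infty.
- apply: (@squeeze_cvge _ _ _ _ (cst 0%E) _
    (fun n => (eps^-1)%:E * \int[P]_om f n om)%E).
  + near=> n; rewrite measure_ge0/=.
    by rewrite -lee_pdivrMl ?invr_gt0// invrK; exact: markov_ge0.
  + exact: cvg_cst.
  + by rewrite -[X in _ --> X](mule0 (eps^-1)%:E); exact: cvgeZl.
- by move=> n om /= /negP; rewrite -ltNge.
Unshelve. all: by end_near. Qed.

End whp.

(** * Consequences of independence and of equal distributions *)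

Section independence.
Context {d : measure_display} {Omega : measurableType d} {R : realType}.
Variable P : probability Omega R.
Implicit Types X Y : {RV P >-> R}.

Lemma same_distribution_integral X Y (h : R -> \bar R) :
  same_distribution X Y -> measurable_fun setT h ->
  (\int[P]_om h (X om) = \int[P]_om h (Y om))%E.
Proof.
have ge0_case (f : R -> \bar R) : same_distribution X Y ->
    measurable_fun setT f -> (forall x, 0 <= f x)%E ->
    (\int[P]_om f (X om) = \int[P]_om f (Y om))%E.
  move=> XY mf f0.
  rewrite -(ge0_integral_distribution X mf f0).
  rewrite -(ge0_integral_distribution Y mf f0).
  by apply: eq_measure_integral => A mA _; exact: XY.
move=> XY mh; rewrite integralE [RHS]integralE; congr (_ - _)%E.
- rewrite (funepos_comp h X) (funepos_comp h Y).
  exact: (ge0_case h^\+%E XY (measurable_funepos mh)).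
- rewrite (funeneg_comp h X) (funeneg_comp h Y).
  exact: (ge0_case h^\-%E XY (measurable_funeneg mh)).
Qed.

Lemma bounded_integrable (f : Omega -> R) (M : R) :
  measurable_fun setT f -> (forall om, `|f om| <= M) ->
  P.-integrable setT (EFin \o f).
Proof.
move=> mf fM; apply: measurable_bounded_integrable => //.
  by rewrite (le_lt_trans (probability_le1 _ _)) ?ltry.
exists M; split; first exact: num_real.
by move=> x Mx om _ /=; rewrite (le_trans (fM om))// ltW.
Qed.

Lemma pair_independent (Xs : nat -> {RV P >-> R}) i j (A B : set R) :
  mutually_independent Xs -> i != j -> measurable A -> measurable B ->
  P (Xs i @^-1` A `&` Xs j @^-1` B) =
    (P (Xs i @^-1` A) * P (Xs j @^-1` B))%E.
Proof.
move=> indep ij mA mB.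
have := indep [fset i; j]%fset (fun k => if k == i then A else B).
rewrite big_fsetU1/=; last by rewrite inE.
rewrite big_seq_fset1 eqxx eq_sym (negbTE ij) => <-; last first.
  by move=> k; case: ifP.
congr (P _); apply/seteqP; split.
  move=> om [/= Ai Bj] k /=; rewrite !inE => /orP[|] /eqP ->.
    by rewrite eqxx.
  by rewrite eq_sym (negbTE ij).
move=> om /= ABk; split.
  by have := ABk i; rewrite /= eqxx !inE eqxx /=; exact.
by have := ABk j; rewrite /= eq_sym (negbTE ij) !inE eqxx orbT; exact.
Qed.

(** Independence makes the joint law of the pair agree with the product of the marginal laws on
    rectangles, hence everywhere; by Fubini the inner integral is a multiple of the mean of [g],
    which is 0. The boundedness of [g], available after truncation, supplies all integrability. *)
Lemma independent_integralM0 (Xs : nat -> {RV P >-> R}) i j (g : R -> R)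
    (M : R) :
  mutually_independent Xs -> i != j -> measurable_fun setT g ->
  (forall x, `|g x| <= M) -> (\int[P]_om (g (Xs j om))%:E = 0)%E ->
  (\int[P]_om (g (Xs i om) * g (Xs j om))%:E = 0)%E.
Proof.
move=> indep ij mg gM g0.
pose Z om := (Xs i om, Xs j om).
have mZ : measurable_fun setT Z by exact: measurable_fun_pair.
pose G (z : R * R) := (g z.1 * g z.2)%:E.
have mG : measurable_fun setT G.
  apply/measurable_EFinP; apply: measurable_funM.
  - exact: measurableT_comp mg measurable_fst.
  - exact: measurableT_comp mg measurable_snd.
have M0 : 0 <= M by rewrite (le_trans _ (gM 0)).
have iGZ : P.-integrable setT (G \o Z).
  apply: (@bounded_integrable (fun om => g (Xs i om) * g (Xs j om)) (M * M)).
    by apply: measurable_funM; exact: measurableT_comp.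
  by move=> om; rewrite normrM ler_pM.
pose mu := distribution P (Xs i); pose nu := distribution P (Xs j).
have munuE (A : set (R * R)) : measurable A ->
    (mu \x nu)%E A = pushforward P Z A.
  apply: product_measure_unique => A1 A2 mA1 mA2.
  exact: pair_independent.
have iG : (mu \x nu)%E.-integrable setT G.
  apply/integrableP; split => //.
  have /integrableP[_] := integrable_pushforward mZ mG iGZ measurableT.
  congr (_ < _)%E; apply: eq_measure_integral => A mA _; exact/esym/munuE.
transitivity (\int[P]_om (G \o Z) om)%E; first by [].
rewrite -(integral_pushforward mZ mG iGZ measurableT).
transitivity (\int[(mu \x nu)%E]_z G z)%E.
  by apply: eq_measure_integral => A mA _; exact/esym/munuE.
rewrite -integral12_prod_meas1//.
apply: integral0_eq => x _ /=.
rewrite /fubini_F /G /=; under eq_integral do rewrite EFinM.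
have ig : nu.-integrable setT (EFin \o g).
  apply: integrable_pushforward => //; first exact/measurable_EFinP.
  rewrite preimage_setT.
  by apply: (@bounded_integrable (g \o Xs j) M) => //=; exact: measurableT_comp.
rewrite integralZl// integral_distribution//=; last 2 first.
- exact/measurable_EFinP.
- by apply: (@bounded_integrable (g \o Xs j) M) => //=; exact: measurableT_comp.
by rewrite g0 mule0.
Qed.

End independence.

(** * Weak law of large numbers *)

Lemma ge0_cvge0P {R : realType} (u : nat -> \bar R) : (forall n, 0 <= u n)%E ->
  u @ \oo --> 0%E <->
  (forall e : R, 0 < e -> \forall n \near \oo, (u n <= e%:E)%E).
Proof.
move=> u0; split=> [/fine_cvgP[ufin /cvgrPdist_le ue] e e0|ue].
  near=> n; rewrite -(@fineK _ (u n)); last by near: n.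
  rewrite lee_fin -[leLHS]ger0_norm ?fine_ge0// -[X in `|X|]opprK normrN -sub0r.
  by near: n; exact: ue.
apply/fine_cvgP; split.
  near=> n; rewrite ge0_fin_numE// (@le_lt_trans _ _ 1%:E) ?ltry//.
  by near: n; exact: ue.
apply/cvgrPdist_le => e e0; near=> n => /=.
rewrite sub0r normrN ger0_norm ?fine_ge0// -lee_fin fineK.
  by near: n; exact: ue.
rewrite ge0_fin_numE// (@le_lt_trans _ _ 1%:E) ?ltry//.
by near: n; exact: ue.
Unshelve. all: by end_near. Qed.

Section law_of_large_numbers.
Context {d : measure_display} {Omega : measurableType d} {R : realType}.
Variable P : probability Omega R.
Variables (X : {RV P >-> R}) (Xs : nat -> {RV P >-> R}).
Hypothesis Xs_iid : iid_copies X Xs.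

(** The empirical mean of [h], taken as a function of the pair (n, omega) so that its limit along
    [whp] can be stated directly. *)
Definition avg (h : R -> R) (u : nat * Omega) : R :=
  u.1%:R^-1 * \sum_(j < u.1) h (Xs j u.2).

Lemma measurable_avg (h : R -> R) n : measurable_fun setT h ->
  measurable_fun setT (fun om => avg h (n, om)).
Proof.
move=> mh; rewrite /avg /=; apply: measurable_funM => //.
by apply: measurable_sum => j; exact: measurableT_comp.
Qed.

(** When the square is expanded, independence and centring annihilate the off-diagonal products, and
    each of the n diagonal terms is at most M^2. *)
Lemma integral_sqr_sum_le (g : R -> R) (M : R) n : measurable_fun setT g ->
  (forall x, `|g x| <= M) -> (\int[P]_om (g (X om))%:E = 0)%E ->
  (\int[P]_om ((\sum_(j < n) g (Xs j om)) ^+ 2)%:E <= (n%:R * M ^+ 2)%:E)%E.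
Proof.
move=> mg gM g0; have [indep same] := Xs_iid.
have M0 : 0 <= M by rewrite (le_trans _ (gM 0)).
have mgX i : measurable_fun setT (g \o Xs i) by exact: measurableT_comp.
have ig i j : P.-integrable setT (fun om => (g (Xs i om) * g (Xs j om))%:E).
  apply: (@bounded_integrable _ _ _ _ (fun om => g (Xs i om) * g (Xs j om)) (M * M)).
    by apply: measurable_funM; exact: mgX.
  by move=> om; rewrite normrM ler_pM.
have g0' j : (\int[P]_om (g (Xs j om))%:E = 0)%E.
  rewrite -g0; apply: (@same_distribution_integral _ _ _ _ _ _ (EFin \o g)) => //.
  exact/measurable_EFinP.
under eq_integral => om _.
  rewrite expr2 big_distrlr -sumEFin /=.
  under eq_bigr do rewrite -sumEFin.
  over.
rewrite integral_sum//; last by move=> i; exact: integrable_sum.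
rewrite (@le_trans _ _ (\sum_(i < n) (M ^+ 2)%:E)%E)//; last first.
  by rewrite sumEFin sumr_const card_ord mulr_natl.
apply: lee_sum => i _; rewrite integral_sum//.
rewrite (bigD1 i)//= big1 ?adde0; last first.
  move=> j ji; apply: (independent_integralM0 indep _ mg gM) => //.
  by rewrite eq_sym.
apply: (@le_trans _ _ (\int[P]_om (M ^+ 2)%:E)%E).
  apply: ge0_le_integral => //.
  - by move=> om _; rewrite lee_fin -expr2 sqr_ge0.
  - by apply/measurable_EFinP; apply: measurable_funM; exact: mgX.
  - move=> om _; rewrite lee_fin -expr2 -real_normK ?num_real//.
    by rewrite lerXn2r ?nnegrE.
by rewrite integral_cst//= probability_setT mule1.
Qed.

(** Dominated convergence with majorant |f|: at each point the tail vanishes as soon as k >= |f|. *)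
Lemma integral_tail_cvg (f : Omega -> R) : P.-integrable setT (EFin \o f) ->
  (\int[P]_om (`|f om| * (k%:R < `|f om|)%R%:R)%:E @[k --> \oo] --> 0)%E.
Proof.
move=> intf; have /measurable_EFinP mf := measurable_int _ intf.
have mtail k : measurable_fun setT
    (fun om => (`|f om| * (k%:R < `|f om|)%R%:R)%:E).
  apply/measurable_EFinP; apply: measurable_funM.
    exact: measurableT_comp.
  apply: measurable_fun_natr_bool.
  by apply: measurable_fun_ltr => //; exact: measurableT_comp.
have [|||_ _] := @dominated_convergence _ _ _ P _ measurableT
  (fun k om => (`|f om| * (k%:R < `|f om|)%R%:R)%:E) (cst 0%E)
  (fun om => `|f om|%:E) mtail (@measurable_cst _ _ _ _ _ _).
- apply: aeW => om _; apply: cvg_near_cst; near=> k.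
  rewrite ltNge (_ : `|f om| <= k%:R) ?mulr0//.
  near: k; exact: nbhs_infty_ger.
- exact: integrable_norm.
- apply: aeW => om k _; rewrite lee_fin normrM normr_id ler_piMr//.
  by rewrite normr_nat lern1 leq_b1.
- by rewrite integral_cst// mul0e; exact.
Unshelve. all: by end_near. Qed.

Lemma integral_avg (h : R -> R) n : measurable_fun setT h ->
  (forall x, 0 <= h x) -> (0 < n)%N ->
  (\int[P]_om (avg h (n, om))%:E = \int[P]_om (h (X om))%:E)%E.
Proof.
move=> mh h0 n0; have [_ same] := Xs_iid.
have mhX j : measurable_fun setT (fun om => (h (Xs j om))%:E).
  by apply/measurable_EFinP; exact: measurableT_comp.
under eq_integral do rewrite /avg /= EFinM -sumEFin.
rewrite ge0_integralZl//; last 2 first.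
- exact: emeasurable_sum.
- by move=> om _; apply: sume_ge0 => j _; rewrite lee_fin.
rewrite ge0_integral_sum//; last by move=> j om _; rewrite lee_fin.
rewrite (eq_bigr (fun=> \int[P]_om (h (X om))%:E)%E); last first.
  move=> j _; apply: (@same_distribution_integral _ _ _ _ _ _ (EFin \o h)) => //.
  exact/measurable_EFinP.
rewrite big_const_ord -Monoid.iteropE -/(enatmul _ n) -mule_natl muleA -EFinM mulVf ?mul1e//.
by rewrite pnatr_eq0 -lt0n.
Qed.

Lemma avg_cst n c om : (0 < n)%N -> avg (cst c) (n, om) = c.
Proof.
move=> n0; rewrite /avg sumr_const card_ord /= -(mulr_natl c) mulrA mulVf ?mul1r//.
by rewrite pnatr_eq0 -lt0n.
Qed.

Lemma avgD h1 h2 u : avg (fun x => h1 x + h2 x) u = avg h1 u + avg h2 u.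
Proof. by rewrite /avg big_split mulrDr. Qed.

Lemma ler_avg h1 h2 u : (forall x, h1 x <= h2 x) -> avg h1 u <= avg h2 u.
Proof.
by move=> h12; rewrite /avg ler_wpM2l ?invr_ge0// ler_sum.
Qed.

Lemma ler_norm_avg h u : `|avg h u| <= avg (Num.norm \o h) u.
Proof.
rewrite /avg normrM ger0_norm ?invr_ge0// ler_wpM2l ?invr_ge0//.
exact: ler_norm_sum.
Qed.

(** Only a first moment is assumed, so Chebyshev applies to the part of [h] truncated at level k,
    while the rest is small in mean. The argument gives convergence in mean, from which convergence
    in probability follows. *)
Theorem weak_law_of_large_numbers (h : R -> R) : measurable_fun setT h ->
  P.-integrable setT (fun om => (h (X om))%:E) ->
  avg h @ whp P --> (\int[P]_om h (X om))%R.
Proof.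
move=> mh ih; set m := (\int[P]_om h (X om))%R.
suff L1 : (\int[P]_om (`|avg h (n, om) - m|)%:E @[n --> \oo] --> 0)%E.
  apply/cvgrPdist_lt => e e0.
  have : \forall u \near whp P, (`|avg h (u.1, u.2) - m|%:E < e%:E)%E.
    apply: (whp_lt_of_cvg_integral (f := fun n om => `|avg h (n, om) - m|%:E)) => //.
    move=> n; apply/measurable_EFinP; apply: measurableT_comp => //.
    by apply: measurable_funB => //; exact: measurable_avg.
  by apply: filterS => -[n om] /=; rewrite lte_fin distrC.
apply/ge0_cvge0P => [n|e e0].
  by apply: integral_ge0 => om _; rewrite lee_fin.
(* Four errors of size [del]: the truncated-away tail, the shift |c - m| of the mean it causes, and
   the two terms of the bound |a| <= del + a^2 / del for the centred average. *)
pose del := e / 4.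
have del0 : 0 < del by rewrite divr_gt0.
have [k tailk] : exists k : nat,
    (\int[P]_om (`|h (X om)| * (k%:R < `|h (X om)|)%R%:R)%:E <= del%:E)%E.
  have /ge0_cvge0P/(_ _ del0)[|k _ tail] := integral_tail_cvg ih.
    by move=> k; apply: integral_ge0 => om _; rewrite lee_fin mulr_ge0.
  by exists k; apply: tail => /=.
pose tl x := `|h x| * (k%:R < `|h x|)%R%:R.
pose t x := h x * (`|h x| <= k%:R)%R%:R.
have tlE x : `|h x - t x| = tl x.
  rewrite /tl /t ltNge; case: (`|h x| <= _); first by rewrite mulr1 mulr0 subrr normr0.
  by rewrite mulr0 mulr1 subr0.
pose c := (\int[P]_om t (X om))%R.
pose g x := t x - c.
have mhk : measurable_fun setT (fun x => `|h x|) by exact: measurableT_comp.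
have mtl : measurable_fun setT tl.
  apply: measurable_funM => //; apply: measurable_fun_natr_bool.
  exact: measurable_fun_ltr.
have mt : measurable_fun setT t.
  apply: measurable_funM => //; apply: measurable_fun_natr_bool.
  exact: measurable_fun_ler.
have tk x : `|t x| <= k%:R.
  rewrite /t; have [hk|_] := leP `|h x| k%:R; first by rewrite mulr1.
  by rewrite mulr0 normr0.
have it : P.-integrable setT (fun om => (t (X om))%:E).
  by apply: (@bounded_integrable _ _ _ _ (t \o X) k%:R) => //=; exact: measurableT_comp.
have gM x : `|g x| <= k%:R + `|c|.
  by rewrite (le_trans (ler_normB _ _))// lerD.
have mg : measurable_fun setT g by exact: measurable_funB.
have g0 : (\int[P]_om (g (X om))%:E = 0)%E.
  under eq_integral do rewrite /g EFinB.
  rewrite integralB//=; last exact: finite_measure_integrable_cst.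
  rewrite integral_cst//= probability_setT mule1.
  by rewrite /c /Rintegral fineK ?subee//; exact: integrable_fin_num.
have cm : `|c - m| <= del.
  rewrite /c /m -RintegralB// -lee_fin.
  apply: le_trans tailk.
  rewrite EFin_normr_Rintegral//; last exact: (integrableB measurableT it ih).
  apply: le_trans (le_abse_integral _ _ _) _ => //.
    by apply/measurable_EFinP; apply: measurable_funB; exact: measurableT_comp.
  by under eq_integral do rewrite /= distrC tlE.
pose M := k%:R + `|c|.
near=> n; have n0 : (0 < n)%N by near: n; exact: nbhs_infty_ge.
have nR0 : 0 < n%:R :> R by rewrite ltr0n.
pose q om := (\sum_(j < n) g (Xs j om)) ^+ 2.
have mq : measurable_fun setT q.
  apply: measurable_funX; apply: measurable_sum => j.
  exact: measurableT_comp.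
have -> : e%:E = (del%:E + (2 * del + del)%:E)%E.
  by rewrite -EFinD; congr EFin; rewrite /del; field.
apply: (@le_trans _ _ (\int[P]_om ((avg tl (n, om))%:E +
    (2 * del + del^-1 * n%:R^-1 ^+ 2 * q om)%:E))%E).
  apply: ge0_le_integral => //.
  - apply/measurable_EFinP; apply: measurableT_comp => //.
    by apply: measurable_funB => //; exact: measurable_avg.
  - apply: emeasurable_funD; apply/measurable_EFinP; first exact: measurable_avg.
    by apply: measurable_funD => //; exact: measurable_funM.
  - move=> om _; rewrite -EFinD lee_fin.
    (* Tail, plus centred truncated average, plus bias of the truncated mean. *)
    have -> : avg h (n, om) - m =
        avg (fun x => h x - t x) (n, om) + (avg g (n, om) + (c - m)).
      have -> : avg h = avg (fun x => (h x - t x) + (g x + cst c x)).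
        by congr avg; apply/funext => x /=; rewrite /g subrK subrK.
      by rewrite (avgD (fun x => h x - t x)) (avgD g) avg_cst//; ring.
    rewrite (le_trans (ler_normD _ _))// lerD//.
      rewrite (le_trans (ler_norm_avg _ _))// ler_avg// => x /=.
      by rewrite tlE.
    rewrite (le_trans (ler_normD _ _))//.
    set a := avg g _; rewrite -mulrA.
    have -> : n%:R^-1 ^+ 2 * q om = a ^+ 2 by rewrite -exprMn.
    (* This passes from the first absolute moment to the second moment without a Cauchy-Schwarz
       inequality for integrals. *)
    have : `|a| <= del + del^-1 * a ^+ 2.
      rewrite -(ler_pM2l del0) mulrDr mulVKf ?gt_eqF//.
      rewrite -(real_normK (num_real a)); have := normr_ge0 a; nra.
    by move: cm; lra.
have C0 : 0 < del^-1 * n%:R^-1 ^+ 2.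
  by rewrite mulr_gt0 ?exprn_gt0 ?invr_gt0.
have Cq0 om : (0 <= (del^-1 * n%:R^-1 ^+ 2 * q om)%:E)%E.
  by rewrite lee_fin mulr_ge0 ?sqr_ge0// ltW.
have del20 : (0 <= (2 * del)%:E)%E by rewrite lee_fin mulr_ge0// ltW.
have q0 om : (0 <= (2 * del + del^-1 * n%:R^-1 ^+ 2 * q om)%:E)%E.
  by rewrite EFinD adde_ge0.
have tl0 om : (0 <= (avg tl (n, om))%:E)%E.
  by rewrite lee_fin mulr_ge0// sumr_ge0// => j _; rewrite mulr_ge0.
have mavg : measurable_fun setT (fun om => (avg tl (n, om))%:E).
  by apply/measurable_EFinP; exact: measurable_avg.
have mCq : measurable_fun setT
    (fun om => (2 * del + del^-1 * n%:R^-1 ^+ 2 * q om)%:E).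
  by apply/measurable_EFinP; apply: measurable_funD => //; exact: measurable_funM.
rewrite ge0_integralD//.
apply: leeD; first by rewrite integral_avg// => x; rewrite mulr_ge0.
have mq' : measurable_fun setT (fun om => (q om)%:E) by exact/measurable_EFinP.
have q0' om : (0 <= (q om)%:E)%E by rewrite lee_fin sqr_ge0.
have mCq' : measurable_fun setT (fun om => (del^-1 * n%:R^-1 ^+ 2 * q om)%:E).
  by apply/measurable_EFinP; exact: measurable_funM.
under eq_integral do rewrite EFinD.
rewrite ge0_integralD// integral_cst//= probability_setT mule1.
rewrite EFinD leeD2l//; under eq_integral do rewrite EFinM.
rewrite ge0_integralZl ?lee_fin ?(ltW C0)//.
apply: (@le_trans _ _ ((del^-1 * n%:R^-1 ^+ 2)%:E * (n%:R * M ^+ 2)%:E)%E).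
  rewrite lee_pmul2l ?lte_fin//.
  exact: integral_sqr_sum_le.
rewrite -EFinM lee_fin.
have -> : del^-1 * n%:R^-1 ^+ 2 * (n%:R * M ^+ 2) = n%:R^-1 * (del^-1 * M ^+ 2).
  by field; rewrite !gt_eqF.
rewrite ler_pdivrMl// -ler_pdivrMr//.
near: n; exact: nbhs_infty_ger.
Unshelve. all: by end_near. Qed.

End law_of_large_numbers.

(** * Dominated convergence in probability *)

Section dominated_convergence_in_probability.
Context {d : measure_display} {Omega : measurableType d} {R : realType}.
Variable P : probability Omega R.

(** Off the exceptional set [Z n] is below e/2; on it [Z n] is at most K, and its probability tends
    to 0. *)
Lemma whp_bounded_cvg_integral (Z : nat -> Omega -> R) (K : R) :
  (forall n, measurable_fun setT (Z n)) -> (forall n om, 0 <= Z n om <= K) ->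
  (fun u => Z u.1 u.2) @ whp P --> (0 : R) ->
  (\int[P]_om (Z n om)%:E @[n --> \oo] --> 0)%E.
Proof.
move=> mZ ZK /cvgrPdist_lt Z0.
have K0 : 0 <= K by have /andP[] := ZK 0 point; exact: le_trans.
apply/ge0_cvge0P => [n|e e0].
  by apply: integral_ge0 => om _; rewrite lee_fin; have /andP[] := ZK n om.
have e20 : 0 < e / 2 by rewrite divr_gt0.
have [B [mB B0 BZ]] := Z0 _ e20.
(* K may be 0; K + 1 keeps the quotient meaningful. *)
have d0 : 0 < e / 2 / (K + 1) by rewrite divr_gt0// ltr_wpDl.
have PB := (ge0_cvge0P (fun n => measure_ge0 P (B n))).1 B0 _ d0.
near=> n.
apply: (@le_trans _ _ (\int[P]_om ((e / 2)%:E + (K + 1)%:E * (\1_(B n) om)%:E))%E).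
  apply: ge0_le_integral => //.
  - by move=> om _; rewrite lee_fin; have /andP[] := ZK n om.
  - exact/measurable_EFinP.
  - apply: emeasurable_funD => //; apply: emeasurable_funM => //.
    by apply/measurable_EFinP; exact: measurable_indic.
  - move=> om _; rewrite -EFinM -EFinD lee_fin indicE.
    have /andP[Z0' ZK'] := ZK n om.
    have [_|/negP nB] := boolP (om \in B n).
      by rewrite mulr1 (le_trans ZK')// ler_wpDl ?ltW// ltrDl.
    rewrite mulr0 addr0 ltW//.
    have := BZ n om; rewrite sub0r normrN /= ger0_norm//; apply.
    by move=> Bom; apply: nB; rewrite inE.
rewrite ge0_integralD//; last 3 first.
- by move=> om _; rewrite lee_fin ltW.
- by move=> om _; rewrite mule_ge0// lee_fin// addr_ge0.
- apply: emeasurable_funM => //.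
  by apply/measurable_EFinP; exact: measurable_indic.
rewrite integral_cst//= probability_setT mule1.
rewrite ge0_integralZl//; last 2 first.
- by apply/measurable_EFinP; exact: measurable_indic.
- by rewrite lee_fin addr_ge0.
rewrite integral_indic// setIT.
apply: (@le_trans _ _ ((e / 2)%:E + (K + 1)%:E * (e / 2 / (K + 1))%:E)%E).
  rewrite leeD2l// lee_pmul2l// ?lte_fin ?ltr_wpDl//.
  by near: n.
rewrite -EFinM -EFinD lee_fin mulrCA divff ?mulr1 -?splitr//.
by rewrite gt_eqF// ltr_wpDl.
Unshelve. all: by end_near. Qed.

Context {d' : measure_display} {T : measurableType d'}.
Variable mu : {sigma_finite_measure set T -> \bar R}.

(** The pointwise limit is in probability for almost every t, so the expectation is taken first: it
    tends to 0 for almost every t, hence so does its integral against W, and Tonelli turns that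
    integral into the expectation of the random integral. *)
Lemma whp_dominated_convergence (f : nat -> Omega * T -> R) (W : T -> R) (K : R) :
  (forall n, measurable_fun setT (f n)) ->
  measurable_fun setT W -> (forall t, 0 <= W t) ->
  mu.-integrable setT (EFin \o W) ->
  {ae mu, forall t, (fun u => f u.1 (u.2, t)) @ whp P --> (0 : R)} ->
  (\forall u \near whp P, forall t, `|f u.1 (u.2, t)| <= K) ->
  forall eps : R, 0 < eps -> \forall u \near whp P,
    (\int[mu]_t (`|f u.1 (u.2, t)| * W t)%:E < eps%:E)%E.
Proof.
move=> mf mW W0 iW fcvg fK eps eps0.
(* The bound on [f] fails on an event of small probability, where its expectation is uncontrolled.
   The truncation is bounded everywhere and equals |f| on the good event; [|K|] is used because the
   sign of K is not known. *)
pose D n z := Num.min `|f n z| `|K|.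
have D0 n z : 0 <= D n z by rewrite le_min !normr_ge0.
have DK n z : D n z <= `|K| by rewrite ge_min lexx orbT.
have mD n : measurable_fun setT (D n).
  by apply: measurable_minr => //; exact: measurableT_comp.
pose G n (z : Omega * T) := (D n z * W z.2)%:E.
have mG n : measurable_fun setT (G n).
  apply/measurable_EFinP; apply: measurable_funM => //.
  exact: measurableT_comp mW measurable_snd.
have G0 n z : (0 <= G n z)%E by rewrite lee_fin mulr_ge0.
pose E n t := (\int[P]_om G n (om, t))%E.
have mE n : measurable_fun setT (E n).
  exact: (measurable_fun_fubini_tonelli_G (G n)).
have mDt n t : measurable_fun setT (fun om => D n (om, t)).
  by apply: measurableT_comp (mD n) _; exact: measurable_fun_pair.
have EE n t : E n t = (\int[P]_om (D n (om, t))%:E * (W t)%:E)%E.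
  rewrite /E /G /=; under eq_integral do rewrite EFinM.
  rewrite ge0_integralZr//; first exact/measurable_EFinP.
    by move=> om _; rewrite lee_fin.
  by rewrite lee_fin.
have E0 t : (fun u => f u.1 (u.2, t)) @ whp P --> (0 : R) ->
    (E n t @[n --> \oo] --> 0)%E.
  move=> ft; rewrite (funext (EE ^~ t)) -[X in _ --> X](mul0e (W t)%:E); apply: cvgeZr => //.
  apply: (@whp_bounded_cvg_integral (fun n om => D n (om, t)) `|K|) => //.
    by move=> n om; rewrite D0 DK.
  apply: (@squeeze_cvgr _ _ _ _ (cst 0) (fun u => `|f u.1 (u.2, t)|)).
  + by apply: nearW => u; rewrite D0/= ge_min lexx.
  + exact: cvg_cst.
  + by rewrite -(@normr0 _ R); exact: cvg_norm.
have : (\int[mu]_t E n t @[n --> \oo] --> 0)%E.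
  have [|||_ _] := @dominated_convergence _ _ _ mu _ measurableT
    E (cst 0%E) (fun t => (`|K| * W t)%:E) mE (@measurable_cst _ _ _ _ _ _).
  - by apply: filterS fcvg => t ft _; exact: E0.
  - exact: (integrableZl measurableT `|K| iW).
  - apply: aeW => t n _; rewrite gee0_abs; last exact: integral_ge0.
    rewrite EE EFinM lee_wpmul2r ?lee_fin//.
    apply: (@le_trans _ _ (\int[P]_om `|K|%:E)%E).
      by apply: ge0_le_integral => //; [move=> om _; rewrite lee_fin|
        exact/measurable_EFinP|move=> om _; rewrite lee_fin].
    by rewrite integral_cst//= probability_setT mule1.
  - by rewrite integral_cst// mul0e; exact.
rewrite -(funext (fun n => fubini_tonelli (G n) (mG n) (G0 n))).
have mGF n : measurable_fun setT (fun om => \int[mu]_t G n (om, t))%E.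
  exact: (measurable_fun_fubini_tonelli_F (G n)).
have GF0 n om : (0 <= \int[mu]_t G n (om, t))%E by exact: integral_ge0.
move=> /(whp_lt_of_cvg_integral mGF GF0)/(_ eps0).
(* On the good event the truncation is inactive. *)
apply: filterS2 fK => -[n om] /= fK.
suff -> : (\int[mu]_t G n (om, t) = \int[mu]_t (`|f n (om, t)| * W t)%:E)%E by [].
apply: eq_integral => t _; rewrite /G /D /= min_l//.
by rewrite (le_trans (fK t))// ler_norm.
Qed.

End dominated_convergence_in_probability.

(** * Measurability of the estimators and of the statistic *)

Section measurability.
Context {d : measure_display} {Omega : measurableType d} {R : realType}.
Variable P : probability Omega R.
Variable Xs : nat -> {RV P >-> R}.

Lemma measurable_inv_fun {d'} {T : measurableType d'} (f : T -> R) :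
  measurable_fun setT f -> measurable_fun setT (fun x => (f x)^-1).
Proof. exact: measurableT_comp measurable_invr. Qed.

Lemma measurable_mu_hat n :
  measurable_fun setT (fun om => mu_hat (sample Xs (n := n) om)).
Proof.
by apply: measurable_funM => //; apply: measurable_sum => j.
Qed.

Lemma measurable_phi_hat m n :
  measurable_fun setT (fun om => phi_hat m (sample Xs (n := n) om)).
Proof.
have mmu := @measurable_mu_hat n.
apply: measurable_funM; last exact: measurable_inv_fun.
case: m => /=.
- apply: measurable_inv_fun; apply: measurable_funM => //.
  apply: measurable_sum => j; apply: measurable_funB; last exact: measurable_inv_fun.
  exact: measurable_inv_fun.
- apply: measurable_funM; first exact: measurable_funX.
  apply: measurable_inv_fun; apply: measurable_funB; last exact: measurable_funX.
  apply: measurable_funM => //; apply: measurable_sum => j.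
  exact: measurable_funX.
Qed.

(** The expression inside the square in [T_stat], as a function of t. *)
Definition residual (m : estimation_method) n (x : 'I_n -> R) (t : R) : R :=
  (2 * n%:R)^-1 *
    \sum_(j < n) ((phi_hat m x + 3 / (x j / mu_hat x)
      - phi_hat m x / (x j / mu_hat x) ^+ 2) * Num.min (x j / mu_hat x) t)
  - n%:R^-1 * \sum_(j < n) (x j / mu_hat x <= t)%R%:R.

Lemma measurable_residual m n : measurable_fun setT
  (fun z : Omega * R => residual m (sample Xs (n := n) z.1) z.2).
Proof.
have fst1 (f : Omega -> R) : measurable_fun setT f ->
    measurable_fun setT (fun z : Omega * R => f z.1).
  by move=> mf; exact: measurableT_comp mf measurable_fst.
have mY j : measurable_fun setT (fun z : Omega * R =>
    sample Xs (n := n) z.1 j / mu_hat (sample Xs (n := n) z.1)).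
  apply: measurable_funM; first exact: (fst1 (Xs j)).
  apply: (fst1 (fun om => (mu_hat (sample Xs (n := n) om))^-1)).
  by apply: measurable_inv_fun; exact: measurable_mu_hat.
have mph := fst1 _ (measurable_phi_hat m n).
have msnd : measurable_fun setT (fun z : Omega * R => z.2) by exact: measurable_snd.
apply: measurable_funB; apply: measurable_funM => //; apply: measurable_sum => j.
- apply: measurable_funM; last exact: measurable_minr.
  apply: measurable_funB.
    apply: measurable_funD => //; apply: measurable_funM => //.
    exact: measurable_inv_fun.
  apply: measurable_funM => //; apply: measurable_inv_fun.
  exact: measurable_funX.
- by apply: measurable_fun_natr_bool; exact: measurable_fun_ler.
Qed.

(** The integrand is jointly measurable in (omega, t) once w is extended by 0, so the integral over
    t is measurable in omega by Tonelli. *)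
Lemma measurable_T_stat (w : R -> R) m n :
  measurable_fun setT (w \_ `]0, +oo[) -> (forall t, 0 < t -> 0 <= w t) ->
  measurable_fun setT (fun om => T_stat w m (sample Xs (n := n) om)).
Proof.
move=> mw w0; pose W := w \_ `]0, +oo[.
have W0 t : 0 <= W t.
  by rewrite /W patchE; case: ifPn => //; rewrite inE/= in_itv/= andbT => /w0.
pose G (z : Omega * R) :=
  (`|residual m (sample Xs (n := n) z.1) z.2| ^+ 2 * W z.2)%:E.
have mG : measurable_fun setT G.
  apply/measurable_EFinP; apply: measurable_funM.
    apply: measurable_funX; apply: measurableT_comp => //.
    exact: measurable_residual.
  exact: measurableT_comp mw measurable_snd.
have G0 z : (0 <= G z)%E by rewrite lee_fin mulr_ge0// exprn_ge0.
apply: emeasurable_funM => //.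
rewrite (_ : (fun _ => _) =
    fun om => \int[lebesgue_measure]_t G (om, t))%E; last first.
  apply/funext => om; rewrite integral_mkcond; apply: eq_integral => t _.
  by rewrite /G /W /= !patchE; case: ifPn => //; rewrite mulr0.
exact: (@measurable_fun_fubini_tonelli_F _ _ Omega _ R lebesgue_measure G mG G0).
Qed.

End measurability.

Lemma integrable_bounded_weight {d} {T : measurableType d} {R : realType}
  (mu : {measure set T -> \bar R}) (D : set T) (g w : T -> R) (K : R) :
  measurable D -> (forall t, D t -> 0 <= w t) ->
  (forall t, D t -> `|g t| <= K) -> measurable_fun D g ->
  mu.-integrable D (EFin \o w) ->
  mu.-integrable D (fun t => (`|g t| ^+ 2 * w t)%:E).
Proof.
move=> mD w0 gK mg iw; have /measurable_EFinP mw := measurable_int _ iw.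
apply: le_integrable (integrableZl mD (K ^+ 2) iw) => //.
  apply/measurable_EFinP; apply: measurable_funM => //.
  by apply: measurable_funX; exact: measurableT_comp.
move=> t Dt /=; have K0 : 0 <= K by exact: le_trans (gK _ Dt).
rewrite lee_fin [leLHS]normrM [leRHS]normrM ler_wpM2r// !normrX normr_id.
rewrite (ger0_norm K0).
by rewrite lerXn2r ?nnegrE// gK.
Qed.

(** * Observations positive everywhere: the sample mean *)

Section positive_observations.
Context {d : measure_display} {Omega : measurableType d} {R : realType}.
Variable P : probability Omega R.
Variables (X : {RV P >-> R}) (Xs : nat -> {RV P >-> R}).
Hypotheses (Xs_iid : iid_copies X Xs).
Hypotheses (X_gt0 : forall om, 0 < X om) (Xs_gt0 : forall j om, 0 < Xs j om).
Hypothesis EX1 : (\int[P]_om X om = 1)%R.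
Hypothesis iX : P.-integrable setT (fun om => (X om)%:E).
Hypothesis iV : P.-integrable setT (fun om => ((X om)^-1)%:E).

Local Notation mean := (avg Xs idfun).

Lemma mean_cvg : mean @ whp P --> (1 : R).
Proof.
rewrite -EX1; apply: (weak_law_of_large_numbers Xs_iid) => //.
exact: measurable_id.
Qed.

Lemma mean_gt0 : \forall u \near whp P, 0 < mean u.
Proof. exact: (cvgr_gt _ mean_cvg). Qed.

(** * Averages of truncated quotients *)

Lemma integrable_power_quotient k : (k <= 2)%N ->
  P.-integrable setT (fun om => (X om / X om ^+ k)%:E).
Proof.
case: k => [|[|[|//]]] _.
- by under eq_fun do rewrite expr0 divr1.
- under eq_fun do rewrite expr1 divff ?gt_eqF//.
  exact: finite_measure_integrable_cst.
- by under eq_fun do rewrite expr2 invfM mulrA divff ?gt_eqF// mul1r.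
Qed.

Lemma measurable_power_quotient (f : R -> R) k : measurable_fun setT f ->
  measurable_fun setT (fun x => f x / x ^+ k).
Proof.
move=> mf; apply: measurable_funM => //; apply: measurable_inv_fun.
exact: measurable_funX.
Qed.

(** For k = 0, 1, 2 these are the three pieces of the first sum of the statistic. They are dominated
    by x / x^k, that is by x, 1 and 1/x, exactly the functions whose expectations are finite. *)
Definition trunc_quotient k (t x : R) := Num.min x t / x ^+ k.

Lemma measurable_trunc_quotient k t : measurable_fun setT (trunc_quotient k t).
Proof. by apply: measurable_power_quotient; exact: measurable_minr. Qed.

Lemma trunc_quotient_ge0 k t x : 0 <= t -> 0 < x -> 0 <= trunc_quotient k t x.
Proof.
by move=> t0 x0; rewrite divr_ge0 ?exprn_ge0 ?le_min ?t0 ?(ltW x0).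
Qed.

Let invX_ge0 k (x : R) : 0 < x -> 0 <= (x ^+ k)^-1.
Proof. by move=> x0; rewrite invr_ge0 exprn_ge0// ltW. Qed.

Lemma trunc_quotient_le k t x : 0 < x -> trunc_quotient k t x <= x / x ^+ k.
Proof.
by move=> x0; rewrite /trunc_quotient ler_wpM2r ?invX_ge0// ge_min lexx.
Qed.

Lemma integrable_trunc_quotient k t : (k <= 2)%N -> 0 <= t ->
  P.-integrable setT (fun om => (trunc_quotient k t (X om))%:E).
Proof.
move=> k2 t0; apply: le_integrable (integrable_power_quotient k2) => //.
  apply/measurable_EFinP; apply: measurableT_comp => //.
  exact: measurable_trunc_quotient.
move=> om _ /=; rewrite lee_fin ger0_norm ?trunc_quotient_ge0//.
by rewrite (le_trans _ (ler_norm _))// trunc_quotient_le.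
Qed.

(** Rescaling moves into the threshold, at the price of the factor c^(k-1), written c^k / c to cover
    k = 0. *)
Lemma trunc_quotientZ k t c x : 0 < c -> 0 < x ->
  trunc_quotient k t (x / c) = c ^+ k / c * (Num.min x (t * c) / x ^+ k).
Proof.
move=> c0 x0; rewrite /trunc_quotient.
have -> : Num.min (x / c) t = Num.min x (t * c) / c.
  by rewrite minr_pMl ?invr_ge0 ?ltW// mulfK ?gt_eqF.
by rewrite expr_div_n; field; rewrite !expf_neq0 ?gt_eqF.
Qed.

Lemma trunc_quotientZ_le k t c x : 0 < t -> 0 < c -> 0 < x ->
  trunc_quotient k t (x / c) <= c ^+ k / c * (x / x ^+ k).
Proof.
move=> t0 c0 x0; rewrite trunc_quotientZ//.
rewrite ler_wpM2l ?(divr_ge0, exprn_ge0, ltW c0)//.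
by rewrite ler_wpM2r ?invX_ge0// ge_min lexx.
Qed.

(** The Lipschitz bound t |c - 1| on the change of the minimum would leave t / x^k, which for k = 2
    requires E X^-2. When the two minima differ, the smaller of x and t can be used in the estimate,
    which gives |c - 1| x instead. *)
Lemma trunc_quotientZ_dist k t c x : 0 < t -> 0 < c -> 0 < x ->
  `|trunc_quotient k t (x / c) - trunc_quotient k t x| <=
  (`|c ^+ k / c - 1| + `|c - 1|) * (x / x ^+ k).
Proof.
move=> t0 c0 x0; rewrite trunc_quotientZ// /trunc_quotient mulrA -mulrBl.
rewrite normrM [X in _ * X]ger0_norm ?invX_ge0// mulrA.
rewrite ler_wpM2r ?invX_ge0//.
set a := c ^+ k / c; set m' := Num.min x (t * c); set m := Num.min x t.
have m'0 : 0 <= m' by rewrite le_min !ltW ?mulr_gt0.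
have m'x : m' <= x by rewrite ge_min lexx.
have mm' : `|m' - m| <= `|c - 1| * x.
  rewrite /m' /m; case: (leP x (t * c)); case: (leP x t) => xt xtc.
  - by rewrite subrr normr0 mulr_ge0// ltW.
  - have tc1 : t * (c - 1) <= `|c - 1| * x.
      rewrite mulrC; apply: le_trans (_ : `|c - 1| * t <= _).
        by rewrite ler_wpM2r ?ler_norm// ltW.
      by rewrite ler_wpM2l// ltW.
    by rewrite gtr0_norm ?subr_gt0//; nra.
  - have xc1 : x * (1 - c) <= `|c - 1| * x.
      by rewrite mulrC ler_wpM2r ?(ltW x0)// distrC ler_norm.
    by rewrite distrC gtr0_norm ?subr_gt0//; nra.
  - rewrite -[X in _ - X]mulr1 -mulrBr normrM mulrC (gtr0_norm t0).
    by rewrite ler_wpM2l// ltW.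
(* The error of the prefactor and the error of the threshold are separated; m' <= x bounds the
   former. *)
have -> : a * m' - m = (a - 1) * m' + (m' - m) by ring.
rewrite (le_trans (ler_normD _ _))// [leRHS]mulrDl lerD// normrM (ger0_norm m'0).
by rewrite ler_wpM2l.
Qed.

Lemma scaled_trunc_quotient_cvg k t : (k <= 2)%N -> 0 < t ->
  (fun u => avg Xs (fun x => trunc_quotient k t (x / mean u)) u) @ whp P -->
  (\int[P]_om trunc_quotient k t (X om))%R.
Proof.
move=> k2 t0; pose b x : R := x / x ^+ k.
apply: (@cvg_sub0 _ _ _ _ _ _ (avg Xs (trunc_quotient k t))); last first.
  apply: (weak_law_of_large_numbers Xs_iid).
    exact: measurable_trunc_quotient.
  exact: integrable_trunc_quotient (ltW t0).
apply/norm_cvg0P.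
apply: (@squeeze_cvgr _ _ _ _ (cst 0)
  (fun u => (`|mean u ^+ k / mean u - 1| + `|mean u - 1|) * avg Xs b u)).
- apply: filterS mean_gt0 => u mu0; rewrite normr_ge0/=.
  rewrite [X in `|X|](_ : _ = avg Xs (fun x =>
      trunc_quotient k t (x / mean u) - trunc_quotient k t x) u); last first.
    by rewrite /avg sumrB mulrBr.
  set c := mean u in mu0 *.
  rewrite /avg normrM ger0_norm ?invr_ge0// mulrCA.
  rewrite ler_wpM2l ?invr_ge0// mulr_sumr (le_trans (ler_norm_sum _ _ _))//.
  by apply: ler_sum => j _; exact: trunc_quotientZ_dist.
- exact: cvg_cst.
- rewrite -[X in _ --> X](mul0r (\int[P]_om b (X om))%R); apply: cvgM; last first.
    apply: (weak_law_of_large_numbers Xs_iid).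
      exact: measurable_power_quotient.
    exact: integrable_power_quotient.
  have z : 0 = `|1 ^+ k / 1 - 1| + `|1 - 1| :> R.
    by rewrite expr1n divr1 subrr normr0 addr0.
  rewrite [X in _ --> X]z; apply: cvgD; apply: cvg_norm; apply: cvgB => //.
  + apply: cvgM; last by apply: cvgV => //; exact: mean_cvg.
    apply: (@cvg_comp _ _ _ mean (fun x : R => x ^+ k) _ (nbhs (1 : R))).
      exact: mean_cvg.
    exact: exprn_continuous.
  + exact: cvg_cst.
  + exact: mean_cvg.
  + exact: cvg_cst.
Qed.

(** * The empirical distribution function at a random threshold *)

Lemma measurable_indic_le t : measurable_fun setT (fun x : R => (x <= t)%R%:R : R).
Proof. by apply: measurable_fun_natr_bool; exact: measurable_fun_ler. Qed.

Lemma measurable_indic_near t e :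
  measurable_fun setT (fun x : R => (`|x - t| <= e)%R%:R : R).
Proof.
apply: measurable_fun_natr_bool; apply: measurable_fun_ler => //.
by apply: measurableT_comp => //; exact: measurable_funB.
Qed.

Lemma integrable_natr_bool (b : R -> bool) :
  measurable_fun setT (fun x => (b x)%:R : R) ->
  P.-integrable setT (fun om => ((b (X om))%:R)%:E).
Proof.
move=> mb; apply: (@bounded_integrable _ _ _ _ (fun om => (b (X om))%:R) 1).
  exact: measurableT_comp mb _.
by move=> om; rewrite normr_nat lern1 leq_b1.
Qed.

(** Continuity from above: the events |X - t| <= 1/(k+1) decrease to the null event X = t. It is
    carried out as dominated convergence of indicators. *)
Lemma near_prob_small t e : P [set om | X om = t] = 0%E -> 0 < e ->
  exists2 del, 0 < del & (\int[P]_om (`|X om - t| <= del)%R%:R)%R <= e.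
Proof.
move=> Pt0 e0; pose f k om : \bar R := ((`|X om - t| <= k.+1%:R^-1)%R%:R)%:E.
have mf k : measurable_fun setT (f k).
  by apply/measurable_EFinP; exact: measurableT_comp (measurable_indic_near t _) _.
have f0 k om : (0 <= f k om)%E by rewrite lee_fin.
have f1 k om : (`|f k om| <= 1)%E.
  by rewrite gee0_abs// lee_fin lern1 leq_b1.
have [|||_ _] := @dominated_convergence _ _ _ P _ measurableT f (cst 0%E) (cst 1%E)
  mf (@measurable_cst _ _ _ _ _ _).
- exists [set om | X om = t]; split => //.
    exact: (measurable_funPTI X (measurable_set1 t)).
  move=> om /=; apply: contra_notP => /eqP Xt _; apply: cvg_near_cst.
  have : 0 < `|X om - t| by rewrite normr_gt0 subr_eq0.
  move=> d0; near=> k; rewrite /f leNgt.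
  suff -> : k.+1%:R^-1 < `|X om - t| by [].
  by near: k; exact: near_infty_natSinv_lt (PosNum d0).
- exact: finite_measure_integrable_cst.
- by apply: aeW => om k _; exact: f1.
rewrite integral_cst// mul0e => /ge0_cvge0P/(_ _ e0)[k|k _ fk].
  exact: integral_ge0.
exists (k.+1%:R^-1); first by rewrite invr_gt0.
rewrite -lee_fin /Rintegral fineK; first exact: fk (leqnn k).
apply: integrable_fin_num => //.
exact: (integrable_natr_bool (measurable_indic_near t k.+1%:R^-1)).
Unshelve. all: by end_near. Qed.

(** The indicator is discontinuous, so closeness of the mean to 1 gives no bound for a single
    observation. But the indicators for the thresholds t and t times the mean differ only for
    observations within [del] of t, and the frequency of those has a limit at most e/2. *)
Lemma scaled_cdf_cvg t : 0 < t -> P [set om | X om = t] = 0%E ->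
  (fun u => avg Xs (fun x => (x / mean u <= t)%R%:R) u) @ whp P -->
  (\int[P]_om (X om <= t)%R%:R)%R.
Proof.
move=> t0 Pt0.
apply: (@cvg_sub0 _ _ _ _ _ _ (avg Xs (fun x => (x <= t)%R%:R))); last first.
  apply: (weak_law_of_large_numbers Xs_iid); first exact: measurable_indic_le.
  exact: (integrable_natr_bool (measurable_indic_le t)).
apply/cvgr0Pnorm_lt => e e0.
have e20 : 0 < e / 2 by rewrite divr_gt0.
have [del del0 Pdel] := near_prob_small Pt0 e20.
have near_cvg : avg Xs (fun x => (`|x - t| <= del)%R%:R) @ whp P -->
    (\int[P]_om (`|X om - t| <= del)%R%:R)%R.
  apply: (weak_law_of_large_numbers Xs_iid); first exact: measurable_indic_near.
  exact: (integrable_natr_bool (measurable_indic_near t del)).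
have near_lt : \forall u \near whp P, avg Xs (fun x => (`|x - t| <= del)%R%:R) u < e.
  apply: (cvgr_lt _ near_cvg); rewrite (le_lt_trans Pdel)//.
  by rewrite ltr_pdivrMr// ltr_pMr// ltr1n.
have tmean : \forall u \near whp P, `|t * mean u - t| <= del.
  have : (fun u => t * mean u) @ whp P --> t * 1.
    by apply: cvgM; [exact: cvg_cst|exact: mean_cvg].
  rewrite mulr1 => /cvgrPdist_le/(_ _ del0); apply: filterS => u.
  by rewrite distrC.
near=> u.
have mu0 : 0 < mean u by near: u; exact: mean_gt0.
apply: le_lt_trans (_ : avg Xs (fun x => (`|x - t| <= del)%R%:R) u < e); last first.
  by near: u.
rewrite [X in `|X|](_ : _ = avg Xs (fun x =>
    (x / mean u <= t)%R%:R - (x <= t)%R%:R) u); last first.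
  by rewrite /avg sumrB mulrBr.
rewrite (le_trans (ler_norm_avg _ _ _))// ler_avg// => x /=.
rewrite ler_pdivrMr//.
have : `|t * mean u - t| <= del by near: u.
set c := t * mean u; rewrite ler_norml => /andP[c1 c2].
have [xc|cx] := leP x c; have [xt|tx] := leP x t; rewrite ?subrr ?normr0//.
- rewrite subr0 normr1 ler1n lt0b; rewrite gtr0_norm ?subr_gt0//.
  by move: c2; lra.
- rewrite sub0r normrN normr1 ler1n lt0b ler0_norm ?subr_le0//.
  by move: c1; lra.
Unshelve. all: by end_near. Qed.

(** * Limits of [phi_hat] *)

Lemma phi_hat_ML_cvg : (\int[P]_om (X om)^-1)%R != 1 ->
  (fun u => phi_hat ML (sample Xs (n := u.1) u.2)) @ whp P -->
  ((\int[P]_om (X om)^-1)%R - 1)^-1.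
Proof.
move=> v1.
have icvg : avg Xs GRing.inv @ whp P --> (\int[P]_om (X om)^-1)%R.
  by apply: (weak_law_of_large_numbers Xs_iid) => //; exact: measurable_invr.
have : (fun u => (avg Xs GRing.inv u - (mean u)^-1)^-1 / mean u) @ whp P -->
    ((\int[P]_om (X om)^-1)%R - 1^-1)^-1 / 1.
  have mc := mean_cvg.
  apply: cvgM; last by apply: cvgV.
  apply: cvgV; first by rewrite invr1 subr_eq0.
  by apply: cvgB => //; exact: cvgV.
rewrite invr1 mulr1; apply: cvg_trans; apply: near_eq_cvg.
have : \forall u \near whp P, (0 < u.1)%N.
  exact: (near_whp (Q := fun n => (0 < n)%N) _ (nbhs_infty_ge 1)).
apply: filterS => -[n om] /= n0; rewrite /phi_hat /lambda_hat.
rewrite sumrB mulrBr sumr_const card_ord -(mulr_natl (_^-1)) mulrA mulVf ?mul1r//.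
by rewrite pnatr_eq0 -lt0n.
Qed.

Lemma phi_hat_MO_cvg : P.-integrable setT (fun om => (X om ^+ 2)%:E) ->
  (\int[P]_om (X om ^+ 2))%R != 1 ->
  (fun u => phi_hat MO (sample Xs (n := u.1) u.2)) @ whp P -->
  ((\int[P]_om (X om ^+ 2))%R - 1)^-1.
Proof.
move=> iS s1.
have scvg : avg Xs (fun x => x ^+ 2) @ whp P --> (\int[P]_om (X om ^+ 2))%R.
  exact: (weak_law_of_large_numbers Xs_iid).
have : (fun u => mean u ^+ 3 / (avg Xs (fun x => x ^+ 2) u - mean u ^+ 2) / mean u)
    @ whp P --> 1 ^+ 3 / ((\int[P]_om (X om ^+ 2))%R - 1 ^+ 2) / 1.
  have mc := mean_cvg.
  have mX k : (fun u => mean u ^+ k) @ whp P --> (1 : R) ^+ k.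
    apply: (@cvg_comp _ _ _ mean (fun x : R => x ^+ k) _ (nbhs (1 : R))) => //.
    exact: exprn_continuous.
  apply: cvgM; last by apply: cvgV.
  apply: cvgM => //; apply: cvgV; first by rewrite expr1n subr_eq0.
  exact: cvgB.
by rewrite !expr1n divr1 mul1r.
Qed.

(** * Convergence and boundedness of the inner expression *)

(** Taking [phi_hat] out of the averages leaves products of separately convergent factors. *)
Lemma residualE m n om t : residual m (sample Xs (n := n) om) t =
  2^-1 * (phi_hat m (sample Xs (n := n) om) *
      avg Xs (fun x => trunc_quotient 0 t (x / mean (n, om))) (n, om)
    + 3 * avg Xs (fun x => trunc_quotient 1 t (x / mean (n, om))) (n, om)
    - phi_hat m (sample Xs (n := n) om) *
      avg Xs (fun x => trunc_quotient 2 t (x / mean (n, om))) (n, om))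
  - avg Xs (fun x => (x / mean (n, om) <= t)%R%:R) (n, om).
Proof.
congr (_ - _); rewrite invfM -mulrA; congr (_ * _).
set ph := phi_hat m _; set c := mean _.
rewrite /avg /= (eq_bigr (fun j : 'I_n => ph * trunc_quotient 0 t (Xs j om / c) +
  3 * trunc_quotient 1 t (Xs j om / c) - ph * trunc_quotient 2 t (Xs j om / c))).
  by rewrite sumrB big_split /= -!mulr_sumr; ring.
move=> j _; rewrite /trunc_quotient expr0 expr1 divr1 -[mu_hat _]/c.
by rewrite -[sample Xs om j]/(Xs j om); ring.
Qed.

Variables (m : estimation_method) (phi : R).
Hypothesis phi_cvg :
  (fun u => phi_hat m (sample Xs (n := u.1) u.2)) @ whp P --> phi.

(** The expression inside the square in Delta, its expectation split by linearity to match
    [residualE]. *)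
Definition limit_residual (t : R) : R :=
  2^-1 * (phi * (\int[P]_om trunc_quotient 0 t (X om))%R
    + 3 * (\int[P]_om trunc_quotient 1 t (X om))%R
    - phi * (\int[P]_om trunc_quotient 2 t (X om))%R)
  - (\int[P]_om (X om <= t)%R%:R)%R.

Lemma residual_cvg t : 0 < t -> P [set om | X om = t] = 0%E ->
  (fun u => residual m (sample Xs (n := u.1) u.2) t) @ whp P --> limit_residual t.
Proof.
move=> t0 Pt0; under eq_fun do rewrite residualE -surjective_pairing.
apply: cvgB; last exact: scaled_cdf_cvg.
apply: cvgM; first exact: cvg_cst.
apply: cvgB; last by apply: cvgM => //; exact: scaled_trunc_quotient_cvg.
apply: cvgD; first by apply: cvgM => //; exact: scaled_trunc_quotient_cvg.
by apply: cvgM; [exact: cvg_cst|exact: scaled_trunc_quotient_cvg].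
Qed.

(** Serves both the empirical averages and the expectations; the summand 1 accounts for the
    distribution function F. *)
Lemma residual_form_bound p h0 h1 h2 q0 q1 q2 F : 0 <= h0 <= q0 ->
  0 <= h1 <= q1 -> 0 <= h2 <= q2 -> 0 <= F <= 1 ->
  `|2^-1 * (p * h0 + 3 * h1 - p * h2) - F| <=
  2^-1 * (`|p| * q0 + 3 * q1 + `|p| * q2) + 1 :> R.
Proof.
move=> /andP[h00 hq0] /andP[h10 hq1] /andP[h20 hq2] /andP[F0 F1].
have ph0 : `|p * h0| <= `|p| * q0 by rewrite normrM (ger0_norm h00) ler_wpM2l.
have ph2 : `|p * h2| <= `|p| * q2 by rewrite normrM (ger0_norm h20) ler_wpM2l.
move: ph0 ph2; rewrite !ler_norml => /andP[? ?] /andP[? ?].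
by apply/andP; split; lra.
Qed.

Lemma residual_bounded : exists K : R, \forall u \near whp P,
  forall t, 0 < t -> `|residual m (sample Xs (n := u.1) u.2) t| <= K.
Proof.
pose b k (x : R) : R := x / x ^+ k.
pose beta k := (\int[P]_om b k (X om))%R.
(* The bound min{y,t} <= y removes t, so the average of truncated quotients is at most [q k]
   uniformly in t. *)
pose q k u := mean u ^+ k / mean u * avg Xs (b k) u.
have qcvg k : (k <= 2)%N -> q k @ whp P --> 1 ^+ k / 1 * beta k.
  move=> k2; apply: cvgM; last first.
    apply: (weak_law_of_large_numbers Xs_iid).
      exact: measurable_power_quotient.
    exact: integrable_power_quotient.
  have mc := mean_cvg.
  apply: cvgM; last by apply: cvgV.
  apply: (@cvg_comp _ _ _ mean (fun x : R => x ^+ k) _ (nbhs (1 : R))) => //.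
  exact: exprn_continuous.
pose C (p q0 q1 q2 : R) : R := 2^-1 * (`|p| * q0 + 3 * q1 + `|p| * q2) + 1.
pose K0 := C phi (1 ^+ 0 / 1 * beta 0) (1 ^+ 1 / 1 * beta 1) (1 ^+ 2 / 1 * beta 2).
have Ccvg : (fun u => C (phi_hat m (sample Xs (n := u.1) u.2))
    (q 0 u) (q 1 u) (q 2 u)) @ whp P --> K0.
  have np : (fun u => `|phi_hat m (sample Xs (n := u.1) u.2)|) @ whp P --> `|phi|.
    exact: cvg_norm.
  apply: cvgD; last exact: cvg_cst.
  apply: cvgM; first exact: cvg_cst.
  apply: cvgD; last by apply: cvgM => //; exact: qcvg.
  apply: cvgD; first by apply: cvgM => //; exact: qcvg.
  by apply: cvgM; [exact: cvg_cst|exact: qcvg].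
(* K0 is the limit of the random bound; the margin 1 makes the bound hold with probability tending
   to 1. *)
exists (K0 + 1).
have CK : \forall u \near whp P, C (phi_hat m (sample Xs (n := u.1) u.2))
    (q 0 u) (q 1 u) (q 2 u) <= K0 + 1.
  by apply: (cvgr_le _ Ccvg); rewrite ltrDl.
near=> u => t t0.
have mu0 : 0 < mean u by near: u; exact: mean_gt0.
apply: le_trans (_ : C (phi_hat m (sample Xs (n := u.1) u.2))
    (q 0 u) (q 1 u) (q 2 u) <= _); last by near: u.
have u0 : (0 < u.1)%N.
  by near: u; exact: (near_whp (Q := fun n => (0 < n)%N) _ (nbhs_infty_ge 1)).
rewrite residualE -surjective_pairing.
have hq k : 0 <= avg Xs (fun x => trunc_quotient k t (x / mean u)) u <= q k u.
  set c := mean u in mu0 *; rewrite /q -/c /avg; apply/andP; split.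
    rewrite mulr_ge0// sumr_ge0// => j _.
    by rewrite trunc_quotient_ge0 ?(ltW t0)// divr_gt0.
  rewrite [leRHS]mulrCA ler_wpM2l ?invr_ge0// mulr_sumr ler_sum// => j _.
  exact: trunc_quotientZ_le.
apply: residual_form_bound => //.
apply/andP; split; first by rewrite mulr_ge0// sumr_ge0.
rewrite /avg ler_pdivrMl ?ltr0n// mulr1.
rewrite (le_trans (_ : _ <= \sum_(j < u.1) (1 : R)))//.
  by apply: ler_sum => j _; rewrite lern1 leq_b1.
by rewrite sumr_const card_ord.
Unshelve. all: by end_near. Qed.

Lemma integral_natr_bool_itv (b : R -> bool) :
  measurable_fun setT (fun x => (b x)%:R : R) ->
  0 <= (\int[P]_om (b (X om))%:R)%R <= 1.
Proof.
move=> mb; apply/andP; split; first exact: Rintegral_ge0.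
apply: le_trans (_ : (\int[P]_om 1)%R <= 1).
  apply: le_Rintegral => //; first exact: integrable_natr_bool.
    exact: finite_measure_integrable_cst.
  by move=> om _; rewrite lern1 leq_b1.
by rewrite Rintegral_cst//= probability_setT /= mul1r.
Qed.

Lemma limit_residual_bounded : exists K : R, forall t, 0 < t ->
  `|limit_residual t| <= K.
Proof.
pose beta k := (\int[P]_om (X om / X om ^+ k))%R.
exists (2^-1 * (`|phi| * beta 0 + 3 * beta 1 + `|phi| * beta 2) + 1) => t t0.
have hb k : (k <= 2)%N -> 0 <= (\int[P]_om trunc_quotient k t (X om))%R <= beta k.
  move=> k2; apply/andP; split.
    by apply: Rintegral_ge0 => om _; exact: trunc_quotient_ge0 (ltW t0) _.
  apply: le_Rintegral => //; first exact: integrable_trunc_quotient (ltW t0).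
    exact: integrable_power_quotient.
  by move=> om _; exact: trunc_quotient_le.
apply: residual_form_bound; try exact: hb.
exact: (integral_natr_bool_itv (measurable_indic_le t)).
Qed.

(* Clipped at 0: for [t < 0] the expectations may diverge, which would break the
   monotonicity in [t] used here. *)
Lemma measurable_limit_residual :
  measurable_fun setT (fun t : R => limit_residual (Num.max t 0)).
Proof.
have mk k : (k <= 2)%N -> measurable_fun setT
    (fun t : R => \int[P]_om trunc_quotient k (Num.max t 0) (X om))%R.
  move=> k2; apply: nondecreasing_measurable => // s t st.
  apply: le_Rintegral => //.
  - by apply: integrable_trunc_quotient => //; rewrite le_max lexx orbT.
  - by apply: integrable_trunc_quotient => //; rewrite le_max lexx orbT.
  - move=> om _; rewrite /trunc_quotient ler_wpM2r ?invX_ge0//.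
    by rewrite le_min !ge_min !ge_max !le_max lexx st lexx !orbT.
have mF : measurable_fun setT
    (fun t : R => \int[P]_om (X om <= Num.max t 0)%R%:R)%R.
  apply: nondecreasing_measurable => // s t st.
  apply: le_Rintegral => //; try exact: (integrable_natr_bool (measurable_indic_le _)).
  move=> om _; have [Xs0|_] := leP (X om) (Num.max s 0); last by [].
  rewrite (le_trans Xs0)// ge_max !le_max st lexx orbT//.
apply: measurable_funB; last exact: mF.
apply: measurable_funM => //; apply: measurable_funB.
  apply: measurable_funD; apply: measurable_funM => //; exact: mk.
by apply: measurable_funM => //; exact: mk.
Qed.

(** * Convergence of the integrated statistic *)

(** The distance of the two integrals is at most the weighted integral of the difference of squares,
    which is bounded with high probability and tends to 0 for almost every t. *)
Lemma T_stat_cvg (w : R -> R) :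
  measurable_fun setT (w \_ `]0, +oo[) -> (forall t, 0 < t -> 0 <= w t) ->
  (\int[lebesgue_measure]_(t in `]0%R, +oo[) (w t)%:E < +oo)%E ->
  forall eps : R, 0 < eps -> \forall u \near whp P,
    (`|T_stat w m (sample Xs (n := u.1) u.2) * (u.1%:R^-1)%:E -
       \int[lebesgue_measure]_(t in `]0%R, +oo[)
         (`|limit_residual t| ^+ 2 * w t)%:E| <= eps%:E)%E.
Proof.
move=> mw w0 iw eps eps0; pose W := w \_ `]0, +oo[.
have W0 t : 0 <= W t.
  by rewrite /W patchE; case: ifPn => //; rewrite inE/= in_itv/= andbT => /w0.
have iW : lebesgue_measure.-integrable setT (EFin \o W).
  apply/integrableP; split; first exact/measurable_EFinP.
  move: iw; rewrite integral_mkcond; congr (_ < _)%E; apply: eq_integral => t _ /=.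
  by rewrite ger0_norm ?W0// /W !patchE; case: ifPn.
pose pos (t : R) : R := (0 < t)%R%:R.
have mpos : measurable_fun setT pos.
  by apply: measurable_fun_natr_bool; exact: measurable_fun_ltr.
(* The factor [pos] and the clipping at 0 extend the difference of squares from t > 0 to a
   measurable function on the whole product space, equal to 0 for t <= 0. *)
pose f n (z : Omega * R) : R :=
  (residual m (sample Xs (n := n) z.1) z.2 ^+ 2 -
    limit_residual (Num.max z.2 0) ^+ 2) * pos z.2.
have msnd (g : R -> R) : measurable_fun setT g ->
    measurable_fun setT (fun z : Omega * R => g z.2).
  by move=> mg; exact: measurableT_comp mg measurable_snd.
have mf n : measurable_fun setT (f n).
  apply: measurable_funM; last exact: msnd mpos.
  apply: measurable_funB; apply: measurable_funX.
    exact: measurable_residual.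
  exact: (msnd (fun t => limit_residual (Num.max t 0)) measurable_limit_residual).
have [K1 resK] := residual_bounded.
have [K2 limK] := limit_residual_bounded.
have sqr_bound (x K : R) : `|x| <= K -> x ^+ 2 <= K ^+ 2.
  move=> xK; rewrite -(real_normK (num_real x)) lerXn2r ?nnegrE//.
  exact: le_trans xK.
have fK : \forall u \near whp P, forall t, `|f u.1 (u.2, t)| <= K1 ^+ 2 + K2 ^+ 2.
  apply: filterS resK => u resK t; rewrite /f /pos /=.
  have [t0|_] := ltP 0 t; last by rewrite mulr0 normr0 addr_ge0 ?sqr_ge0.
  rewrite mulr1 (le_trans (ler_normB _ _))// !ger0_norm ?sqr_ge0//.
  by rewrite lerD// sqr_bound ?resK ?limK.
have fcvg : {ae lebesgue_measure, forall t : R,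
    (fun u => f u.1 (u.2, t)) @ whp P --> (0 : R)}.
  have fcvg_cont t : P [set om | X om = t] = 0%E ->
      (fun u => f u.1 (u.2, t)) @ whp P --> (0 : R).
    move=> Pt0; rewrite /f /pos /=.
    have [t0|_] := ltP 0 t; last first.
      by under eq_fun do rewrite mulr0; exact: cvg_cst.
    under eq_fun do rewrite mulr1.
    rewrite -(subrr (limit_residual t ^+ 2)).
    apply: cvgB; last exact: cvg_cst.
    apply: (@cvg_comp _ _ _ _ (fun x : R => x ^+ 2) _ (nbhs (limit_residual t))).
      exact: residual_cvg.
    exact: exprn_continuous.
  exists [set t | 0 < pmf X t]; split.
  - exact: countable_measurable (pmf_gt0_countable X).
  - exact: countable_lebesgue_measure0 (pmf_gt0_countable X).
  - move=> t /= Pt; rewrite /pmf fine_gt0//.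
    rewrite -ge0_fin_numE// fin_num_measure// andbT.
    by rewrite lt0e measure_ge0 andbT; apply: contra_notN Pt => /eqP/fcvg_cont.
have := @whp_dominated_convergence _ Omega R P _ _ lebesgue_measure f W _
  mf mw W0 iW fcvg fK eps eps0.
have n_gt0 := near_whp P (nbhs_infty_ge 1).
move=> small; apply: filterS3 small resK n_gt0 => u small {}resK u0.
pose D : set R := `]0, +oo[%classic.
have Dgt0 t : D t -> 0 < t by rewrite /D/= in_itv/= andbT.
have mD : measurable D by exact: measurable_itv.
pose F t := (`|residual m (sample Xs (n := u.1) u.2) t| ^+ 2 * w t)%:E.
pose G t := (`|limit_residual t| ^+ 2 * w t)%:E.
have mwD : measurable_fun D w by exact/(measurable_restrictT _ mD).
have iwD : lebesgue_measure.-integrable D (EFin \o w).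
  apply/integrableP; split; first exact/measurable_EFinP.
  move: iw; congr (_ < _)%E; apply: eq_integral => t /=.
  by rewrite inE => /Dgt0 t0; rewrite ger0_norm ?w0.
have mres : measurable_fun [set: R] (residual m (sample Xs (n := u.1) u.2)).
  have := measurableT_comp (@measurable_residual _ _ _ P Xs m u.1)
    (@pair1_measurable _ _ _ _ u.2).
  exact.
(* On the event where the inner expression is bounded both integrals are finite, which permits
   subtracting them as extended reals. *)
have iF : lebesgue_measure.-integrable D F.
  apply: (@integrable_bounded_weight _ _ R lebesgue_measure D
    (residual m (sample Xs (n := u.1) u.2)) w K1 mD _ _ _ iwD).
  - by move=> t /Dgt0; exact: w0.
  - by move=> t /Dgt0; exact: resK.
  apply: measurable_funTS.
  exact: mres.
have mlim : measurable_fun (D : set R) limit_residual.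
  apply: (eq_measurable_fun (fun t : R => limit_residual (Num.max t 0))).
    by move=> t; rewrite inE => /Dgt0 t0; rewrite (max_idPl (ltW t0)).
  exact: measurable_funTS measurable_limit_residual.
have iG : lebesgue_measure.-integrable D G.
  apply: (@integrable_bounded_weight _ _ R lebesgue_measure D
    limit_residual w K2 mD _ _ _ iwD).
  - by move=> t /Dgt0; exact: w0.
  - by move=> t /Dgt0; exact: limK.
  exact: mlim.
rewrite [X in (`|X - _|)%E](_ : _ = \int[lebesgue_measure]_(t in D) F t)%E; last first.
  rewrite /T_stat muleC muleA -EFinM mulVf ?mul1e//.
  by rewrite pnatr_eq0 -lt0n.
rewrite -[X in (`|_ - X|)%E]/(\int[lebesgue_measure]_(t in D) G t)%E.
rewrite -integralB//; apply: le_trans (ltW small).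
apply: le_trans (le_abse_integral _ _ _) _ => //.
  by have := integrableB _ iF iG; move=> /(_ mD)/measurable_int.
rewrite integral_mkcond le_eqVlt; apply/orP; left; apply/eqP.
apply: eq_integral => t _; rewrite /W !patchE.
case: ifPn => [tD|_]; last by rewrite mulr0.
have t0 : 0 < t by apply: Dgt0; rewrite inE in tD.
rewrite /F /G /f /pos /= t0 mulr1 (max_idPl (ltW t0)).
rewrite -mulrBl normrM (ger0_norm (w0 _ t0)).
by rewrite !real_normK ?num_real.
Qed.

End positive_observations.

(** * From almost surely positive to everywhere positive observations *)

Section positive_modification.
Context {d : measure_display} {Omega : measurableType d} {R : realType}.
Variable P : probability Omega R.

Lemma ae_whp (Q : Omega -> Prop) : {ae P, forall om, Q om} ->
  \forall u \near whp P, Q u.2.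
Proof.
move=> [N [mN N0 QN]]; apply: (@whpI _ _ _ _ _ (fun=> N)) => //.
  by rewrite N0; exact: cvg_cst.
by move=> n om /= nN; apply: contrapT => nQ; exact/nN/QN.
Qed.

(* Replacing every observation [x] by [posify x] changes nothing almost surely and
   makes all of them positive everywhere. *)
Definition posify (x : R) : R := if 0 < x then x else 1.

Lemma posify_gt0 x : 0 < posify x.
Proof. by rewrite /posify; case: ifP. Qed.

Lemma posify_id x : 0 < x -> posify x = x.
Proof. by rewrite /posify => ->. Qed.

Lemma measurable_posify : measurable_fun setT posify.
Proof.
apply: measurable_fun_ifT => //; exact: measurable_fun_ltr.
Qed.

Definition posify_rv (X : {RV P >-> R}) : {RV P >-> R} :=
  HB.pack (posify \o X) (isMeasurableFun.Build _ _ _ _ (posify \o X)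
    (measurableT_comp measurable_posify (measurable_funPT X))).

Lemma iid_posify X (Xs : nat -> {RV P >-> R}) : iid_copies X Xs ->
  iid_copies (posify_rv X) (fun j => posify_rv (Xs j)).
Proof.
have mpos A : measurable A -> measurable (posify @^-1` A).
  by move=> mA; rewrite -[X in measurable X]setTI; exact: measurable_posify.
move=> [indep same]; split.
  move=> J A mA; apply: (indep J (fun j => posify @^-1` A j)) => j.
  exact: mpos.
by move=> j A mA; exact: (same j (posify @^-1` A) (mpos _ mA)).
Qed.

Lemma iid_ae_gt0 X (Xs : nat -> {RV P >-> R}) : iid_copies X Xs ->
  {ae P, forall om, 0 < X om} -> {ae P, forall om, forall j, 0 < Xs j om}.
Proof.
move=> [_ same] [N [mN N0 XN]]; apply: ae_foralln => j.
pose A : set R := [set x | x <= 0].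
have mA : measurable A.
  by rewrite (_ : A = `]-oo, 0]%classic)//; apply/seteqP; split => x /=; rewrite in_itv.
exists (Xs j @^-1` A); split.
- exact: measurable_funPTI.
- transitivity (P (X @^-1` A)); first exact: (same j A mA).
  apply: (subset_measure0 _ mN _ N0); first exact: measurable_funPTI.
  by move=> om /= X0; apply: XN => /=; rewrite ltNge X0.
- by move=> om /= /negP; rewrite -leNgt.
Qed.

(** A nonnegative function with zero integral vanishes almost everywhere. Used to see that the
    denominators in the limit of [phi_hat] do not vanish. *)
Lemma not_ae_cst_integral_neq0 (X : {RV P >-> R}) (g : R -> R) c :
  ~ {ae P, forall om, X om = c} -> measurable_fun setT g ->
  (forall om, 0 <= g (X om)) -> (forall om, g (X om) = 0 -> X om = c) ->
  (\int[P]_om (g (X om))%:E)%E != 0%E.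
Proof.
move=> Xc mg g0 gc; apply/eqP => int0; apply: Xc.
have : (\int[P]_om `|(g (X om))%:E| = 0)%E.
  by rewrite -int0; apply: eq_integral => om _; rewrite gee0_abs// lee_fin.
have mgX : measurable_fun setT (fun om => (g (X om))%:E).
  by apply/measurable_EFinP; exact: measurableT_comp.
move=> /(ae_eq_integral_abs _ measurableT mgX).1.
by apply: filterS => om /(_ I)/= [] /gc.
Qed.

Lemma integral_posify (X : {RV P >-> R}) (h : R -> R) :
  {ae P, forall om, 0 < X om} -> measurable_fun setT h ->
  (\int[P]_om (h (posify_rv X om))%:E = \int[P]_om (h (X om))%:E)%E.
Proof.
move=> X0 mh; apply: ae_eq_integral => //.
- by apply/measurable_EFinP; exact: measurableT_comp.
- by apply/measurable_EFinP; exact: measurableT_comp.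
- by apply: filterS X0 => om X0 _; rewrite /= posify_id.
Qed.

(** An expectation below +oo gives integrability only together with a sign; after the modification
    the sign of [h] on positive arguments holds everywhere. *)
Lemma integrable_posify (X : {RV P >-> R}) (h : R -> R) :
  {ae P, forall om, 0 < X om} -> measurable_fun setT h ->
  (forall x, 0 < x -> 0 <= h x) -> ('E_P[fun om => h (X om)] < +oo)%E ->
  P.-integrable setT (fun om => (h (posify_rv X om))%:E).
Proof.
move=> X0 mh h0; rewrite unlock -integral_posify// => hfin.
apply/integrableP; split; first by apply/measurable_EFinP; exact: measurableT_comp.
rewrite (eq_integral (fun om => (h (posify_rv X om))%:E))// => om _.
by rewrite gee0_abs// lee_fin h0//= posify_gt0.
Qed.

Lemma integral_Rintegral (f : Omega -> R) :
  P.-integrable setT (fun om => (f om)%:E) ->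
  (\int[P]_om (f om)%:E)%E = ((\int[P]_om f om)%R)%:E.
Proof. by move=> intf; rewrite fineK//; exact: integrable_fin_num. Qed.

Lemma integral_lin3 (a b c : R) (f g h : Omega -> R) :
  P.-integrable setT (fun om => (f om)%:E) ->
  P.-integrable setT (fun om => (g om)%:E) ->
  P.-integrable setT (fun om => (h om)%:E) ->
  (\int[P]_om (a * f om + b * g om + c * h om)%:E)%E =
  (a * (\int[P]_om f om)%R + b * (\int[P]_om g om)%R + c * (\int[P]_om h om)%R)%:E.
Proof.
move=> intf intg inth.
have iZ k (l : Omega -> R) : P.-integrable setT (fun om => (l om)%:E) ->
    P.-integrable setT (fun om => (k * l om)%:E).
  by move=> il; exact: (integrableZl measurableT k il).
have intZ k (l : Omega -> R) : P.-integrable setT (fun om => (l om)%:E) ->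
    (\int[P]_om (k * l om)%:E)%E = (k * (\int[P]_om l om)%R)%:E.
  move=> il; under eq_integral do rewrite EFinM.
  by rewrite integralZl// integral_Rintegral.
under eq_integral do rewrite EFinD.
rewrite integralD//; last 2 first.
- exact: (integrableD measurableT (iZ a _ intf) (iZ b _ intg)).
- exact: iZ.
under eq_integral do rewrite EFinD.
rewrite integralD//; [|exact: iZ|exact: iZ].
by rewrite !intZ.
Qed.

End positive_modification.

(** * Identification of the limit *)

Section limit_identification.
Context {d : measure_display} {Omega : measurableType d} {R : realType}.
Variables (P : probability Omega R) (X : {RV P >-> R}).
Hypothesis X_gt0 : {ae P, forall om, 0 < X om}.
Local Notation X' := (posify_rv X).
Hypothesis iX : P.-integrable setT (fun om => (X' om)%:E).
Hypothesis iV : P.-integrable setT (fun om => ((X' om)^-1)%:E).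

(** Linearity applies because the minimum is distributed over the sum before splitting: each
    truncated quotient is integrable, whereas X^-2 alone need not be. *)
Lemma expectation_trunc_quotient (phi t : R) : 0 <= t ->
  'E_P[fun om => (2^-1 * (phi + 3 / X om - phi / X om ^+ 2) * Num.min (X om) t)%R]%E =
  (2^-1 * (phi * (\int[P]_om trunc_quotient 0 t (X' om))%R
    + 3 * (\int[P]_om trunc_quotient 1 t (X' om))%R
    - phi * (\int[P]_om trunc_quotient 2 t (X' om))%R))%:E.
Proof.
move=> t0; rewrite unlock.
rewrite -(@integral_posify _ _ _ _ _
  (fun x => 2^-1 * (phi + 3 / x - phi / x ^+ 2) * Num.min x t))//; last first.
  apply: measurable_funM; last exact: measurable_minr.
  apply: measurable_funM => //; apply: measurable_funB.
    apply: measurable_funD => //; apply: measurable_funM => //.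
    exact: measurable_invr.
  apply: measurable_funM => //; apply: measurable_inv_fun.
  exact: measurable_funX.
have itq k : (k <= 2)%N ->
    P.-integrable setT (fun om => (trunc_quotient k t (X' om))%:E).
  by move=> k2; apply: integrable_trunc_quotient => // om; exact: posify_gt0.
transitivity (\int[P]_om ((2^-1 * phi) * trunc_quotient 0 t (X' om)
    + (2^-1 * 3) * trunc_quotient 1 t (X' om)
    + (- (2^-1 * phi)) * trunc_quotient 2 t (X' om))%:E)%E.
  apply: eq_integral => om _; congr EFin.
  by rewrite /trunc_quotient expr0 expr1 divr1; ring.
rewrite integral_lin3; try exact: itq.
by congr EFin; ring.
Qed.

Lemma prob_le_Rintegral t :
  P [set om | (X om <= t)%R] = ((\int[P]_om (X' om <= t)%R%:R)%R)%:E.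
Proof.
rewrite -integral_Rintegral; last first.
  exact: (integrable_natr_bool X' (measurable_indic_le t)).
rewrite (@integral_posify _ _ _ _ _ (fun x => (x <= t)%R%:R))//; last first.
  exact: measurable_indic_le.
have mA : measurable [set om | (X om <= t)%R].
  rewrite -[X in measurable X]setTI; exact: measurable_fun_ler.
rewrite (eq_integral (fun om => (\1_[set om | (X om <= t)%R] om)%:E)).
  by rewrite integral_indic// setIT.
by move=> om _; rewrite indicE mem_setE.
Qed.

Hypothesis X_not_cst : forall c : R, ~ {ae P, forall om, X om = c}.
Hypothesis EX1 : (\int[P]_om X' om = 1)%R.

Let X'_not_cst c : ~ {ae P, forall om, X' om = c}.
Proof.
move=> X'c; apply: (X_not_cst (c := c)); apply: filterS2 X_gt0 X'c => om X0 /=.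
by rewrite posify_id.
Qed.

(** The function (x - 1)^2 / x = x + 1/x - 2 is nonnegative and vanishes only at 1 among positive x.
    If E X^-1 were 1, its expectation would be 1 + 1 - 2 = 0, forcing X = 1 almost surely. *)
Lemma integral_inv_neq1 : (\int[P]_om (X' om)^-1)%R != 1.
Proof.
apply: contraTneq isT => v1.
have := @not_ae_cst_integral_neq0 _ _ _ P X' (fun x => (x - 1) ^+ 2 / x) 1 (@X'_not_cst 1).
rewrite (eq_integral (fun om => (1 * X' om + 1 * (X' om)^-1 + (- 2) * 1)%:E)).
  rewrite integral_lin3//; last exact: finite_measure_integrable_cst.
  rewrite EX1 v1 Rintegral_cst//= probability_setT /= !mulr1 (_ : 1 + 1 - 2 = 0 :> R).
    rewrite eqxx => h; exfalso; apply: (notF (h _ _ _)).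
    - apply: measurable_funM; last exact: measurable_invr.
      by apply: measurable_funX; exact: measurable_funB.
    - by move=> om; rewrite divr_ge0 ?sqr_ge0// ltW// posify_gt0.
    - move=> om /eqP; rewrite mulf_eq0 invr_eq0 (gt_eqF (posify_gt0 _)) orbF.
      by rewrite sqrf_eq0 subr_eq0 => /eqP.
  by ring.
move=> om _; congr EFin; have := posify_gt0 (X om); rewrite -[posify _]/(X' om).
by move=> x0; field; rewrite gt_eqF.
Qed.

(** If E X^2 were 1, the variance E (X - 1)^2 would be 0, forcing X = 1 almost surely. *)
Lemma integral_sqr_neq1 : P.-integrable setT (fun om => (X' om ^+ 2)%:E) ->
  (\int[P]_om (X' om ^+ 2))%R != 1.
Proof.
move=> iS; apply: contraTneq isT => s1.
have := @not_ae_cst_integral_neq0 _ _ _ P X' (fun x => (x - 1) ^+ 2) 1 (@X'_not_cst 1).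
rewrite (eq_integral (fun om => ((- 2) * X' om + 1 * X' om ^+ 2 + 1 * 1)%:E)).
  rewrite integral_lin3//; last exact: finite_measure_integrable_cst.
  rewrite EX1 s1 Rintegral_cst//= probability_setT /= !mulr1 (_ : - 2 + 1 + 1 = 0 :> R).
    rewrite eqxx => h; exfalso; apply: (notF (h _ _ _)).
    - by apply: measurable_funX; exact: measurable_funB.
    - by move=> om; rewrite sqr_ge0.
    - by move=> om /eqP; rewrite sqrf_eq0 subr_eq0 => /eqP.
  by ring.
by move=> om _; congr EFin; ring.
Qed.

Lemma Delta_limit_residual (w : R -> R) phi :
  Delta w X phi = (\int[lebesgue_measure]_(t in `]0%R, +oo[)
    (`|limit_residual X' phi t| ^+ 2 * w t)%:E)%E.
Proof.
apply: eq_integral => t; rewrite inE/= in_itv/= andbT => t0.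
rewrite expectation_trunc_quotient ?ltW// prob_le_Rintegral.
by rewrite -EFinB /= -!EFinM -expr2.
Qed.

End limit_identification.

(** * The limit theorem for almost surely positive observations *)

Theorem theorem5p1 (R : realType) (d : measure_display)
  (Omega : measurableType d) (P : probability Omega R)
  (X : {RV P >-> R}) (Xs : nat -> {RV P >-> R})
  (m : estimation_method) (w : R -> R)
  (X_pos : {ae P, forall om, 0 < X om})
  (X_not_cst : forall c : R, ~ {ae P, forall om, X om = c})
  (EX : ('E_P[X] = 1)%E)
  (EXV_fin : ('E_P[fun om => (X om)^-1%R] < +oo)%E)
  (EX2_fin : m = MO -> ('E_P[fun om => (X om ^+ 2)%R] < +oo)%E)
  (Xs_iid : iid_copies X Xs)
  (w_adm : admissible_weight Xs w) :
  cvg_in_probability P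
    (fun n om => (T_stat w m (sample Xs (n := n) om) * (n%:R^-1)%:E)%E)
    (Delta w X (phi_lim m X)).
Proof.
have [w_gt0 w_cont w_fin _] := w_adm.
pose D : set R := `]0, +oo[%classic.
have mD : measurable D by exact: measurable_itv.
have mwD : measurable_fun D w.
  exact: subspace_continuous_measurable_fun.
have mw : measurable_fun setT (w \_ D).
  by apply/(measurable_restrictT _ mD).
have w_ge0 t : 0 < t -> 0 <= w t by move=> /w_gt0/ltW.
(* The weight is dominated by (t^2 + 1) w(t). *)
have {}w_fin : (\int[lebesgue_measure]_(t in `]0%R, +oo[) (w t)%:E < +oo)%E.
  apply: le_lt_trans w_fin; apply: ge0_le_integral => //.
  - by move=> t; rewrite /= in_itv/= andbT lee_fin => /w_ge0.
  - exact/measurable_EFinP.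
  - apply/measurable_EFinP; apply: measurable_funM => //.
    by apply: measurable_funTS; apply: measurable_funD => //; exact: measurable_funX.
  - move=> t; rewrite /= in_itv/= andbT lee_fin => t0.
    by rewrite ler_peMl ?w_ge0// lerDr sqr_ge0.
pose X' := posify_rv X; pose Xs' j := posify_rv (Xs j).
have X'_gt0 om : 0 < X' om by exact: posify_gt0.
have Xs'_gt0 j om : 0 < Xs' j om by exact: posify_gt0.
have iid' : iid_copies X' Xs' := iid_posify Xs_iid.
have iX : P.-integrable setT (fun om => (X' om)%:E).
  apply: (integrable_posify (h := idfun)) => //; first exact: measurable_id.
    by move=> x /ltW.
  by rewrite EX ltry.
have iV : P.-integrable setT (fun om => ((X' om)^-1)%:E).
  apply: (integrable_posify (h := GRing.inv)) => //; first exact: measurable_invr.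
  by move=> x x0; rewrite invr_ge0 ltW.
have EX1 : (\int[P]_om X' om = 1)%R.
  move: EX; rewrite unlock.
  rewrite -(integral_posify (h := idfun) X_pos (@measurable_id _ _ _)).
  by rewrite integral_Rintegral// => -[].
have phi_cvg : (fun u => phi_hat m (sample Xs' (n := u.1) u.2)) @ whp P -->
    phi_lim m X.
  case: m EX2_fin => [_|/(_ erefl) EX2].
    have -> : phi_lim ML X = ((\int[P]_om (X' om)^-1)%R - 1)^-1.
      rewrite /phi_lim unlock -(integral_posify (h := GRing.inv))//.
      exact: measurable_invr.
    apply: (phi_hat_ML_cvg iid') => //; exact: integral_inv_neq1.
  have iS : P.-integrable setT (fun om => (X' om ^+ 2)%:E).
    apply: (integrable_posify (h := fun x => x ^+ 2)) => //.
    by move=> x _; exact: sqr_ge0.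
  have -> : phi_lim MO X = ((\int[P]_om X' om ^+ 2)%R - 1)^-1.
    by rewrite /phi_lim unlock -(integral_posify (h := fun x => x ^+ 2)).
  apply: (phi_hat_MO_cvg iid') => //; exact: integral_sqr_neq1.
rewrite Delta_limit_residual//.
apply: whp_cvg_in_probability => [n eps|eps eps0].
  rewrite -[X in measurable X]setTI; apply: emeasurable_fun_o_infty => //.
  apply: measurableT_comp => //; apply: emeasurable_funB => //.
  apply: emeasurable_funM => //.
  exact: measurable_T_stat.
have := T_stat_cvg iid' X'_gt0 Xs'_gt0 EX1 iX iV phi_cvg mw w_ge0 w_fin eps0.
(* Almost surely all observations are positive at once, so the original and the modified samples,
   and hence their statistics, coincide for every n. *)
have same := ae_whp (iid_ae_gt0 Xs_iid X_pos).
apply: filterS2 same => -[n om] /= Xs_gt0.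
suff -> : sample Xs (n := n) om = sample Xs' (n := n) om by [].
by apply/funext => j; rewrite /sample /Xs' /= posify_id.
Qed.
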